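(* Let $k$ be the true number of factors, let $k^*\in\mathbb{N}$ with $\bar p-q_{k^*}>0$, let $0<\alpha\le1$, and assume the alternative hypothesis $H_1$: $k\ne k^*$. Suppose that: (i) there is $C>0$ with $|b_{k,0}(x)-b_{k,0}(y)|\le C|x-y|$ for all $x,y\in\mathbb{R}^k$; $\sup_{t\ge 0}\mathbb{E}[|f_{k,t}|^\ell]<\infty$ for all $\ell\ge 0$; and $b_{k,0}\in C^4_\uparrow(\mathbb{R}^k)$; (ii) $f_{k,t}$ is ergodic with invariant measure $\pi_{f,k}$, i.e. for every $\pi_{f,k}$-integrable $g$, $\frac1T\int_0^T g(f_{k,t})\,dt\to\int g\,d\pi_{f,k}$ in probability as $T\to\infty$; (iii) there is $C>0$ with $|B_{i,0}(x)-B_{i,0}(y)|\le C|x-y|$ for all $x,y\in\mathbb{R}$ and $i=1,\dots,p$; $\sup_{t\ge0}\mathbb{E}[|e_t|^\ell]<\infty$ for all $\ell\ge0$; and $B_{i,0}\in C^4_\uparrow(\mathbb{R})$ for $i=1,\dots,p$; (iv) $\sigma_i>0$ ($i=1,\dots,p$) for every parameter in $\Theta_k$ and every parameter in $\Theta_{k^*}$; (v) $e_t$ is ergodic with invariant measure $\pi_e$, i.e. for every $\pi_e$-integrable $g$, $\frac1T\int_0^T g(e_t)\,dt\to\int g\,d\pi_e$ in probability as $T\to\infty$; (vi) $\mathrm{rank}\,\Delta_k=q_k$; (vii) for $\theta_{k^*}\in\Theta_{k^*}$, $U_{k^*}(\theta_{k^*})=U_{k^*}(\bar\theta_{k^*})$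 implies $\theta_{k^*}=\bar\theta_{k^*}$; (viii) $\Sigma_k(\theta_{k,0})\ne\Sigma_{k^*}(\bar\theta_{k^*})$. Then, as $n\to\infty$ with $h_n\to0$ and $nh_n\to\infty$, the statistic $T_{k^*,n}=nF_{k^*,n}(Q_{XX},\Sigma_{k^*}(\hat\theta_{k^*,n}))$ satisfies $$\mathbb{P}\big(T_{k^*,n}>\chi^2_{\bar p-q_{k^*}}(\alpha)\big)\to1.$$
   Context: Fix integers $p\ge2$ and $r\ge1$. For each number of factors $m$ with $1\le m<p$ (used for $m=k$ and $m=k^*$) the parameter is $\theta_m=(\mathrm{vec}(A_m)^\top,\mathrm{vech}(\Sigma_{ff,m})^\top,\sigma_1^2,\dots,\sigma_p^2)^\top\in\Theta_m\subset\mathbb{R}^{q_m}$, where $A_m\in\mathbb{R}^{(p-m)\times m}$, $\Sigma_{ff,m}=S_mS_m^\top$ with $S_m\in\mathbb{R}^{m\times r}$, $q_m=(p-m)m+\frac{m(m+1)}2+p$, and $\Theta_m$ is convex and compact. $\Lambda_m\in\mathbb{R}^{p\times m}$ has top block $I_m$ and bottom block $A_m$, and $\Sigma_m(\theta_m)=\Lambda_m\Sigma_{ff,m}\Lambda_m^\top+\mathrm{diag}(\sigma_1^2,\dots,\sigma_p^2)$. The data come from the $k$-factor model with true parameter $\theta_{k,0}\in\mathrm{Int}(\Theta_k)$ (components $A_{k,0},\Sigma_{ff,k,0}=S_{k,0}S_{k,0}^\top,\sigma_{i,0}^2$, loading matrix $\Lambda_{k,0}$): $X_t=\Lambda_{k,0}f_{k,t}+e_t$,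 $t\ge0$, with $df_{k,t}=b_{k,0}(f_{k,t})dt+S_{k,0}dW_t$, $f_{k,0}=c_1\in\mathbb{R}^k$, and $de^{(i)}_t=B_{i,0}(e^{(i)}_t)dt+\sigma_{i,0}dB^{(i)}_t$ ($i=1,\dots,p$), $e_0=c_2\in\mathbb{R}^p$; $W$ is an $r$-dimensional standard Wiener process, $B^{(1)},\dots,B^{(p)}$ are independent one-dimensional standard Wiener processes independent of $W$; $b_{k,0}:\mathbb{R}^k\to\mathbb{R}^k$, $B_{i,0}:\mathbb{R}\to\mathbb{R}$; initial values are deterministic. Observations are $X_{t_i^n}$, $t_i^n=ih_n$, $0\le i\le n$, $T=nh_n$, and $Q_{XX}=\frac1T\sum_{i=1}^n(X_{t_i^n}-X_{t_{i-1}^n})(X_{t_i^n}-X_{t_{i-1}^n})^\top$. $\bar p=p(p+1)/2$; vec and vech are vectorization and half-vectorization; $D_p$ is the $p^2\times\bar p$ duplication matrix ($\mathrm{vec}A=D_p\mathrm{vech}A$ for symmetric $A$), $D_p^+=(D_p^\top D_p)^{-1}D_p^\top$, $W_m(\theta_m)=2D_p^+(\Sigma_m(\theta_m)\otimes\Sigma_m(\theta_m))D_p^{+\top}$. $\Delta_k$ is the $\bar p\times q_k$ Jacobian of $\theta_k\mapsto\mathrm{vech}(\Sigma_k(\theta_k))$ at $\theta_{k,0}$. $F_{k^*,n}(Q_{XX},\Sigma_{k^*}(\theta_{k^*}))=(\mathrm{vech}(Q_{XX})-\mathrm{vech}(\Sigma_{k^*}(\theta_{k^*})))^\top W_{k^*}^{-1}(\theta_{k^*})(\mathrm{vech}(Q_{XX})-\mathrm{vech}(\Sigma_{k^*}(\theta_{k^*})))$,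 and $\hat\theta_{k^*,n}$ is a minimizer of this function of $\theta_{k^*}$ over $\Theta_{k^*}$. $U_{k^*}(\theta_{k^*})=(\mathrm{vech}(\Sigma_k(\theta_{k,0}))-\mathrm{vech}(\Sigma_{k^*}(\theta_{k^*})))^\top W_{k^*}^{-1}(\theta_{k^*})(\mathrm{vech}(\Sigma_k(\theta_{k,0}))-\mathrm{vech}(\Sigma_{k^*}(\theta_{k^*})))$, and $\bar\theta_{k^*}$ is a minimizer of $U_{k^*}$ over $\Theta_{k^*}$. $\chi^2_m(\alpha)$ is the upper $\alpha$ point of the chi-squared distribution with $m$ degrees of freedom: the number $c\ge0$ such that a $\chi^2_m$ variable exceeds $c$ with probability $\alpha$. $C^4_\uparrow(\mathbb{R}^d)$ is the set of functions that are four times continuously differentiable and that, together with all derivatives up to order 4, have polynomial growth, i.e. are bounded in absolute value by $C(1+|x|)^C$ for some $C>0$ (componentwise for vector-valued functions). *)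

(* Defs.v *)
From HB Require Import structures.
From mathcomp Require Import all_boot all_order all_algebra.
From mathcomp Require Import mxtens.
From mathcomp Require Import all_classical all_reals all_analysis.
Set Implicit Arguments.
Unset Strict Implicit.
Unset Printing Implicit Defensive.
Import Order.TTheory GRing.Theory Num.Theory.
Import numFieldNormedType.Exports.
Local Open Scope classical_set_scope.
Local Open Scope ring_scope.

(* [vec] stacks columns: entry (i, j) sits at position j * m + i, the index
   convention of [tensmx]. *)
Definition vec (R : realType) (m n : nat) (A : 'M[R]_(m, n)) : 'cV[R]_(n * m) :=
  \col_l A (mxtens_unindex l).2 (mxtens_unindex l).1.

Definition unvec (R : realType) (m n : nat) (v : 'cV[R]_(n * m)) : 'M[R]_(m, n) :=
  \matrix_(i, j) v (mxtens_index (j, i)) 0.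

Definition vdim (p : nat) : nat := (p * p.+1)./2.

(* Positions of the lower triangle, column after column. *)
Definition vech_pairs (p : nat) : seq ('I_p * 'I_p) :=
  [seq ij <- [seq (i, j) | j <- enum 'I_p, i <- enum 'I_p] |
    ((ij.2 : 'I_p) <= (ij.1 : 'I_p))%N].

Definition vech (R : realType) (p : nat) (A : 'M[R]_p) : 'cV[R]_(vdim p) :=
  \col_l nth 0 [seq A ij.1 ij.2 | ij <- vech_pairs p] l.

(* The symmetric matrix with a given half-vectorization. *)
Definition unvech (R : realType) (p : nat) (v : 'cV[R]_(vdim p)) : 'M[R]_p :=
  \matrix_(i, j) nth 0 [seq v l 0 | l <- enum 'I_(vdim p)]
    (index (if (j <= i)%N then (i, j) else (j, i)) (vech_pairs p)).

(* Column l is the vec of the symmetric matrix whose vech is the l-th unit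
   vector; [duplicationP] is the characteristic property. *)
Definition duplication (R : realType) (p : nat) : 'M[R]_(p * p, vdim p) :=
  \matrix_(a, l) vec (unvech (delta_mx l 0)) a 0.

Definition duplication_pinv (R : realType) (p : nat) : 'M[R]_(vdim p, p * p) :=
  invmx ((duplication R p)^T *m duplication R p) *m (duplication R p)^T.

Lemma vecK (R : realType) (m n : nat) : cancel (@vec R m n) (@unvec R m n).
Proof. by move=> A; apply/matrixP => i j; rewrite !mxE mxtens_indexK. Qed.

Lemma mem_vech_pairs p (i j : 'I_p) : ((i, j) \in vech_pairs p) = (j <= i)%N.
Proof.
rewrite mem_filter/= -[RHS]andbT; congr (_ && _).
apply/allpairsP; exists (j, i); split => /=; by rewrite ?mem_enum.
Qed.

Lemma uniq_vech_pairs p : uniq (vech_pairs p).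
Proof.
apply: filter_uniq; apply: allpairs_uniq; rewrite ?enum_uniq // => -[a b] [c d] _ _ /= [-> ->] //.
Qed.

Lemma size_vech_pairs p : size (vech_pairs p) = vdim p.
Proof.
rewrite size_filter -sum1_count big_mkcond big_allpairs_dep/= !big_enum/=.
under eq_bigr => j _ do rewrite big_enum/=.
rewrite exchange_big/= (eq_bigr (fun i : 'I_p => i.+1)); last first.
  move=> i _; rewrite -big_mkcond/=.
  by rewrite -(big_ord_widen p (fun=> 1%N) (ltn_ord i)) sum1_card card_ord.
rewrite -(big_mkord xpredT succn) -[LHS]add0n -(@big_nat_recl _ _ _ _ 0 id)//.
by rewrite bin2_sum bin2 mulnC.
Qed.

Lemma vechK (R : realType) (p : nat) (A : 'M[R]_p) :
  A^T = A -> unvech (vech A) = A.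
Proof.
move=> Asym; apply/matrixP => i j; rewrite mxE.
set ij := if _ then _ else _.
have ijP : ij \in vech_pairs p.
  by rewrite /ij; case: leqP => ji; rewrite mem_vech_pairs// ltnW.
have ltij : (index ij (vech_pairs p) < vdim p)%N.
  by rewrite -size_vech_pairs index_mem.
rewrite (nth_map (Ordinal ltij)) ?size_enum_ord// mxE nth_enum_ord//.
rewrite (nth_map ij) ?index_mem// nth_index// /ij.
by case: ifP => //= _; rewrite -[in LHS]Asym mxE.
Qed.

Lemma unvechK (R : realType) (p : nat) : cancel (@unvech R p) (@vech R p).
Proof.
move=> v; apply/colP => l; rewrite mxE.
have ltl : (l < size (vech_pairs p))%N by rewrite size_vech_pairs.
have [i0 _] : {i0 : 'I_p & True}.
  by case E : (vech_pairs p) ltl => [//|[i j] s] _; exists i.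
rewrite (nth_map (i0, i0))//; set ij := nth _ _ _.
have /[dup] ijP : ij \in vech_pairs p by rewrite mem_nth.
rewrite {1}(surjective_pairing ij) mem_vech_pairs => ji.
rewrite mxE ji -surjective_pairing /ij index_uniq ?uniq_vech_pairs//.
by rewrite (nth_map l) ?size_enum_ord// nth_ord_enum.
Qed.

Lemma unvech_sym (R : realType) (p : nat) (v : 'cV[R]_(vdim p)) :
  (unvech v)^T = unvech v.
Proof.
apply/matrixP => i j; rewrite !mxE; congr (nth _ _ (index _ _)).
by case: ltngtP => // /val_inj ->.
Qed.

Lemma duplicationP (R : realType) (p : nat) (A : 'M[R]_p) :
  A^T = A -> duplication R p *m vech A = vec A.
Proof.
move=> /vechK Asym; rewrite -[in RHS]Asym; apply/colP => a; rewrite !mxE.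
set ij := if _ then _ else _.
have ijP : ij \in vech_pairs p.
  by rewrite /ij; case: leqP => ji; rewrite mem_vech_pairs// ltnW.
have ltij : (index ij (vech_pairs p) < vdim p)%N.
  by rewrite -size_vech_pairs index_mem.
rewrite (nth_map (Ordinal ltij)) ?size_enum_ord//.
rewrite (bigD1 (Ordinal ltij))//= big1 => [|l ll0]; rewrite !mxE -/ij.
  rewrite (nth_map (Ordinal ltij)) ?size_enum_ord//.
  rewrite addr0 (_ : nth _ (enum _) _ = Ordinal ltij); last first.
    by apply: val_inj; rewrite /= nth_enum_ord.
  by rewrite !mxE !eqxx mul1r.
rewrite (nth_map (Ordinal ltij)) ?size_enum_ord// mxE.
rewrite (_ : nth _ (enum _) _ = Ordinal ltij); last first.
  by apply: val_inj; rewrite /= nth_enum_ord.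
by rewrite eq_sym (negbTE ll0) mul0r.
Qed.

(* Lengths of vec A, vech Sff and (sigma_1^2, ..., sigma_p^2). *)
Definition qdim (p m : nat) : nat := m * (p - m) + (vdim m + p).

Definition param (R : realType) (p m : nat) (A : 'M[R]_(p - m, m))
    (Sff : 'M[R]_m) (s2 : 'cV[R]_p) : 'cV[R]_(qdim p m) :=
  col_mx (vec A) (col_mx (vech Sff) s2).

Definition A_of (R : realType) (p m : nat) (theta : 'cV[R]_(qdim p m)) :
  'M[R]_(p - m, m) := unvec (usubmx theta).

Definition Sff_of (R : realType) (p m : nat) (theta : 'cV[R]_(qdim p m)) :
  'M[R]_m := unvech (usubmx (dsubmx theta)).

Definition s2_of (R : realType) (p m : nat) (theta : 'cV[R]_(qdim p m)) :
  'cV[R]_p := dsubmx (dsubmx theta).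

Lemma paramK (R : realType) (p m : nat) (A : 'M[R]_(p - m, m))
    (Sff : 'M[R]_m) (s2 : 'cV[R]_p) : Sff^T = Sff ->
  let theta := param A Sff s2 in
  [/\ A_of theta = A, Sff_of theta = Sff & s2_of theta = s2].
Proof.
move=> Ssym; rewrite /A_of /Sff_of /s2_of /param.
by rewrite !(col_mxKu, col_mxKd) vecK vechK.
Qed.

(* [conform_mx] identifies m + (p - m) rows with p rows; see [LambdaE]. *)
Definition Lambda (R : realType) (p m : nat) (A : 'M[R]_(p - m, m)) :
  'M[R]_(p, m) := conform_mx 0 (col_mx 1%:M A).

Lemma LambdaE (R : realType) (p m : nat) (A : 'M[R]_(p - m, m)) (mp : (m <= p)%N) :
  Lambda A = castmx (subnKC mp, erefl) (col_mx 1%:M A).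
Proof.
have gen a b (e : a = b) (C : 'M[R]_(a, m)) :
    conform_mx (0 : 'M[R]_(b, m)) C = castmx (e, erefl) C.
  by case: b / e; rewrite castmx_id conform_mx_id.
exact: gen.
Qed.

Definition Sigma (R : realType) (p m : nat) (theta : 'cV[R]_(qdim p m)) :
    'M[R]_p :=
  Lambda (A_of theta) *m Sff_of theta *m (Lambda (A_of theta))^T
  + diag_mx (s2_of theta)^T.

Definition Wmat (R : realType) (p m : nat) (theta : 'cV[R]_(qdim p m)) :
    'M[R]_(vdim p) :=
  2 *: (duplication_pinv R p *m (Sigma theta *t Sigma theta)
        *m (duplication_pinv R p)^T).

(* F(Q_XX, Sigma(theta)) for M := Q_XX, and U(theta) for M := Sigma_k(theta_0). *)
Definition discrepancy (R : realType) (p m : nat) (M : 'M[R]_p)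
    (theta : 'cV[R]_(qdim p m)) : R :=
  ((vech M - vech (Sigma theta))^T *m invmx (Wmat theta)
   *m (vech M - vech (Sigma theta))) 0 0.

Definition jacobian_vech_Sigma (R : realType) (p m : nat) (theta0 : 'cV[R]_(qdim p m)) :
    'M[R]_(vdim p, qdim p m) :=
  \matrix_(i, j)
    'D_(delta_mx j 0) (fun theta : 'cV[R]_(qdim p m) => vech (Sigma theta) i 0)
      theta0.

Definition param_space (R : realType) (p m r : nat)
    (Theta : set 'cV[R]_(qdim p m)) : Prop :=
  [/\ convex_set Theta, compact Theta &
      forall theta, Theta theta ->
        exists (A : 'M[R]_(p - m, m)) (S : 'M[R]_(m, r)) (sigma : 'cV[R]_p),
          theta = param A (S *m S^T) (\col_i sigma i 0 ^+ 2)].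

Definition is_argmin (R : realType) (V : Type) (D : set V) (f : V -> R) (x : V) :
  Prop := D x /\ forall y, D y -> f x <= f y.

Definition enorm (R : realType) (d : nat) (x : 'cV[R]_d) : R :=
  Num.sqrt (\sum_i x i 0 ^+ 2).

Definition poly_growth (R : realType) (V : Type) (nrm : V -> R) (f : V -> R) :
  Prop := exists C : R, 0 < C /\ forall x, `|f x| <= C * (1 + nrm x) `^ C.

(* f has all partial derivatives along E up to order n, and these, including f
   itself, are continuous and of polynomial growth. *)
Fixpoint Cpoly (R : realType) (V : normedModType R) (nrm : V -> R) (E : set V)
    (n : nat) (f : V -> R) : Prop :=
  [/\ continuous f, poly_growth nrm f &
      if n is n'.+1 then
        forall v, E v -> (forall x, derivable f x v) /\
                         Cpoly nrm E n' (fun x => 'D_v f x)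
      else True].

Definition C4_poly (R : realType) (d : nat) (b : 'cV[R]_d -> 'cV[R]_d) : Prop :=
  forall i, Cpoly (@enorm R d) (range (fun j => delta_mx j 0)) 4
                  (fun x => b x i 0).

Definition C4_poly1 (R : realType) (B : R -> R) : Prop :=
  Cpoly (V := R^o) (fun x => `|x|) [set 1] 4 B.

(* All processes are indexed by R, of which only the half-line t >= 0 is used. *)

Definition sigma_gen (R : realType) (disp : measure_display)
    (T : measurableType disp) (I : Type) (D : set I) (X : I -> T -> R) :
    set (set T) :=
  <<s \bigcup_(i in D) preimage_set_system setT (X i) measurable >>.

Definition mutual_indep (R : realType) (disp : measure_display)
    (T : measurableType disp) (P : probability T R) (J : finType)
    (F : J -> set (set T)) : Prop :=
  forall (K : {set J}) (A : J -> set T), (forall j, j \in K -> F j (A j)) ->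
    P (\bigcap_(j in [set` K]) A j) = (\prod_(j in K) P (A j))%E.

Definition wiener1 (R : realType) (disp : measure_display)
    (T : measurableType disp) (P : probability T R) (B : R -> T -> R) : Prop :=
  [/\ forall t, 0 <= t -> measurable_fun setT (B t),
      {ae P, forall w, B 0 w = 0},
      forall w, {within `[0, +oo[, continuous (B ^~ w)},
      forall s t, 0 <= s -> s < t -> forall U, measurable U ->
        P ((fun w => B t w - B s w) @^-1` U)
        = normal_prob 0 (Num.sqrt (t - s)) U &
      forall s t, 0 <= s -> s < t ->
        forall A U, sigma_gen `[0, s] B A -> measurable U ->
        P (A `&` (fun w => B t w - B s w) @^-1` U)
        = (P A * P ((fun w => (B t w - B s w)%R) @^-1` U))%E].

Definition wiener (R : realType) (disp : measure_display)
    (T : measurableType disp) (P : probability T R) (r : nat)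
    (W : R -> T -> 'cV[R]_r) : Prop :=
  (forall j, wiener1 P (fun t w => W t w j 0)) /\
  mutual_indep P (fun j => sigma_gen `[0, +oo[ (fun t w => W t w j 0)).

(* Mutual independence of W (as one process), B 0, ..., B (p - 1): the B i are
   independent of each other and jointly independent of W. *)
Definition driving_noise (R : realType) (disp : measure_display)
    (T : measurableType disp) (P : probability T R) (r p : nat)
    (W : R -> T -> 'cV[R]_r) (B : 'I_p -> R -> T -> R) : Prop :=
  [/\ wiener P W, forall i, wiener1 P (B i) &
      mutual_indep P (fun o : option 'I_p =>
        if o is Some i then sigma_gen `[0, +oo[ (B i)
        else sigma_gen (`[0, +oo[ `*` [set: 'I_r])
               (fun tj w => W tj.1 w tj.2 0))].

(* dX_t = drift_t dt + dN_t with X_0 = x0, for a continuous process X. The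
   diffusion coefficients are constant and N_0 = 0 almost surely, so the
   stochastic integral is N_t itself. *)
Definition solves (R : realType) (disp : measure_display)
    (T : measurableType disp) (P : probability T R) (x0 : R)
    (drift N X : R -> T -> R) : Prop :=
  [/\ forall t, 0 <= t -> measurable_fun setT (X t),
      forall w, {within `[0, +oo[, continuous (X ^~ w)} &
      {ae P, forall w, forall t, 0 <= t ->
        X t w = x0 + \int[lebesgue_measure]_(s in `[0, t]) drift s w + N t w}].

Definition bounded_moments (R : realType) (disp : measure_display)
    (T : measurableType disp) (P : probability T R) (d : nat)
    (X : R -> T -> 'cV[R]_d) : Prop :=
  forall l : R, 0 <= l ->
    (ereal_sup [set \int[P]_w (enorm (X t w) `^ l)%:E | t in [set t | 0%R <= t]%R]
     < +oo)%E.

Definition borel (R : realType) (d : nat) :=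
  g_sigma_algebraType (@open 'cV[R]_d).

(* The time integral only makes sense for those pi-integrable g that are
   integrable along almost every path on bounded time intervals. In dimension
   >= 3 this is a genuine restriction: a pi-integrable g can have a singularity
   at the deterministic initial value that makes the integral diverge. *)
Definition ergodic (R : realType) (disp : measure_display)
    (T : measurableType disp) (P : probability T R) (d : nat)
    (X : R -> T -> 'cV[R]_d) (pi : probability (borel R d) R) : Prop :=
  forall g : borel R d -> R, pi.-integrable setT (EFin \o g) ->
    {ae P, forall w, forall t, 0 < t ->
      lebesgue_measure.-integrable `[0, t] (fun s => (g (X s w))%:E)} ->
    forall eps : R, 0 < eps ->
      P [set w | eps <
          `|t^-1 * \int[lebesgue_measure]_(s in `[0, t]) g (X s w)
            - \int[pi]_x g x|]
        @[t --> +oo] --> 0%E.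

Definition observed (R : realType) (T : Type) (p k : nat)
    (A0 : 'M[R]_(p - k, k)) (f : R -> T -> 'cV[R]_k) (e : R -> T -> 'cV[R]_p) :
    R -> T -> 'cV[R]_p :=
  fun t w => Lambda A0 *m f t w + e t w.

Definition QXX (R : realType) (T : Type) (p : nat) (X : R -> T -> 'cV[R]_p)
    (h : nat -> R) (n : nat) (w : T) : 'M[R]_p :=
  (n%:R * h n)^-1 *:
    \sum_(1 <= i < n.+1)
      (X (i%:R * h n) w - X (i.-1%:R * h n) w)
      *m (X (i%:R * h n) w - X (i.-1%:R * h n) w)^T.

Definition Gamma (R : realType) (a : R) : R :=
  \int[lebesgue_measure]_(x in `]0, +oo[) (x `^ (a - 1) * expR (- x)).

Definition chi2_pdf (R : realType) (m : nat) (x : R) : R :=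
  x `^ (m%:R / 2 - 1) * expR (- (x / 2)) / (2 `^ (m%:R / 2) * Gamma (m%:R / 2)).

Definition chi2_upper_point (R : realType) (m : nat) (alpha c : R) : Prop :=
  0 <= c /\
  (\int[lebesgue_measure]_(x in `]c, +oo[) (chi2_pdf m x)%:E = alpha%:E)%E.

(* Main.v *)
(* Under the true model the increments of X are those of a Gaussian martingale
   with covariance rate Sigma(theta_0) plus a drift increment of size O(h_n) in
   L2. The normalized sums of products of Wiener increments converge to the
   identity at rate n^(-1/2) because their centered terms are orthogonal, and the
   terms involving the drift contribute O(sqrt(h_n)); hence Q_XX tends to
   Sigma(theta_0) in L1.

   On the compact Theta_{k*} the weights W^-1 are bounded below by a multiple of
   the identity, and misspecification keeps vech(Sigma(theta)) at a positive
   distance from vech(Sigma(theta_0)). So, as soon as Q_XX is close to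
   Sigma(theta_0), F is at least some kappa > 0 uniformly in theta, and
   n F >= n kappa eventually exceeds any fixed threshold. *)
Require Import Defs.
From HB Require Import structures.
From mathcomp Require Import all_boot all_order all_algebra.
From mathcomp Require Import mxtens.
From mathcomp Require Import all_classical all_reals all_analysis.
From mathcomp Require Import measurable_realfun.
From mathcomp Require Import ring lra zify.
Set Implicit Arguments.
Unset Strict Implicit.
Unset Printing Implicit Defensive.
Import Order.TTheory GRing.Theory Num.Theory.
Import numFieldNormedType.Exports.
Local Open Scope classical_set_scope.
Local Open Scope ring_scope.

(** * Moments of the normal law *)

(** Three obstacles shape the argument. The estimator is an arbitrary selection of minimizers, so
    measurability is established for the minimal value instead of the minimizer. Positivity of the
    weights must hold uniformly although the factor part of Sigma may be rank deficient; the
    positive variances make each W twice a Gram matrix B B^T with B right invertible, and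
    Cauchy-Schwarz then does the work of an eigenvalue bound. The drift is a random process, and
    exchanging expectation with its time integral needs joint measurability, which comes from path
    continuity once time is clamped at 0.

    The Gaussian input is reduced to one fact, that every normal density has mass one: the mean, the
    variance and a crude fourth-moment bound follow from comparing two normal densities. Products
    are estimated by AM-GM with a weight chosen so that both halves have the same order in n and h.
    The r + p scalar Wiener processes are treated as one finite family of pairwise independent
    processes. *)

Section normal_moments.
Context {R : realType}.
Local Notation mu := (@lebesgue_measure R).

(** The Radon-Nikodym derivative and [normal_pdf] have the same integral over every measurable set,
    hence agree almost everywhere, and the change of variables for the former carries over. *)
Lemma ge0_integral_normal_prob (m s : R) (f : R -> \bar R) :
  measurable_fun [set: R] f -> (forall x, 0 <= f x)%E ->
  (\int[normal_prob m s]_x f x = \int[mu]_x (f x * (normal_pdf m s x)%:E))%E.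
Proof.
move=> mf f0; have dom := normal_prob_dominates m s.
rewrite -(Radon_Nikodym_SigmaFinite.change_of_variables dom)//.
have mpdf := measurable_normal_pdf m s.
apply: ae_eq_integral => //.
- apply: emeasurable_funM => //.
  exact: (measurable_int mu (Radon_Nikodym_SigmaFinite.f_integrable dom)).
- by apply: emeasurable_funM => //; exact/measurable_EFinP.
- apply: ae_eqe_mul2l; apply: integral_ae_eq => //.
  + exact: Radon_Nikodym_SigmaFinite.f_integrable.
  + exact/measurable_EFinP.
  + by move=> A _ mA; rewrite -Radon_Nikodym_SigmaFinite.f_integral.
Qed.

(* The likelihood ratio of N(m, u) with respect to N(0, s). *)
Definition normal_ratio (s m u x : R) : R :=
  s / u * expR (x ^+ 2 / (s ^+ 2 *+ 2) - (x - m) ^+ 2 / (u ^+ 2 *+ 2)).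

Lemma normal_ratioE (s m u x : R) : 0 < s -> 0 < u ->
  normal_ratio s m u x * normal_pdf 0 s x = normal_pdf m u x.
Proof.
move=> s0 u0; rewrite !normal_pdfE ?gt_eqF// /normal_ratio.
rewrite /normal_fun subr0 mulrACA; congr (_ * _); last first.
  by rewrite -expRD !mulNr addrAC subrr sub0r.
have peakE v : 0 < v -> normal_peak v = v^-1 * (Num.sqrt (pi *+ 2))^-1.
  move=> v0; rewrite /normal_peak -mulrnAr sqrtrM ?sqr_ge0// sqrtr_sqr gtr0_norm//.
  by rewrite invfM.
by rewrite !peakE// mulrA; congr (_ * _); field; rewrite !gt_eqF.
Qed.


Context d (T : measurableType d) (P : probability T R) (U : T -> R) (s : R).
Hypotheses (mU : measurable_fun setT U) (s0 : 0 < s).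
Hypothesis lawU : forall A, measurable A -> P (U @^-1` A) = normal_prob 0 s A.

Lemma ge0_integral_normal_law (f : R -> R) :
  measurable_fun setT f -> (forall x, 0 <= f x) ->
  (\int[P]_w (f (U w))%:E = \int[mu]_x (f x * normal_pdf 0 s x)%:E)%E.
Proof.
move=> mf f0; have mEf : measurable_fun setT (EFin \o f) by exact/measurable_EFinP.
have mU' : @measurable_fun _ _ T (measurableTypeR R) setT U by exact: mU.
pose X : {mfun T >-> measurableTypeR R} := @mfun_Sub _ _ T (measurableTypeR R) _ (mem_set mU').
transitivity (\int[distribution P X]_x (f x)%:E)%E.
  by rewrite ge0_integral_distribution// => x; rewrite lee_fin.
transitivity (\int[normal_prob 0 s]_x (f x)%:E)%E.
  by apply: eq_measure_integral => A mA _; exact: lawU.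
rewrite ge0_integral_normal_prob//.
Qed.

(** Weighting the law N(0, s) by the ratio gives N(m, u), whose mass is one. All moments below are
    extracted from this identity by varying m and u. *)
Lemma integral_normal_ratio (m u : R) : 0 < u ->
  (\int[P]_w (normal_ratio s m u (U w))%:E = 1)%E.
Proof.
move=> u0; rewrite ge0_integral_normal_law.
- by under eq_integral do rewrite normal_ratioE//; exact: integral_normal_pdf.
- rewrite /normal_ratio; apply: measurable_funM => //; apply: measurableT_comp => //.
  by apply: measurable_funB; apply: measurable_funM => //; apply: measurable_funX => //;
    exact: measurable_funB.
- by move=> x; rewrite mulr_ge0 ?expR_ge0// divr_ge0 ?ltW.
Qed.

(** Instead of the exact value 3 s^4, x^4 is dominated by a multiple of the ratio towards N(0, 2s),
    whose mean is 1. The ratio is at least (1/2)(9/256) x^4 / s^4, and 57 is the least integer above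
    512/9. *)
Lemma normal_fourth_moment : (\int[P]_w (U w ^+ 4)%:E <= (57 * s ^+ 4)%:E)%E.
Proof.
have u0 : 0 < 2 * s by rewrite mulr_gt0.
have m4 : measurable_fun setT (fun w => U w ^+ 4) by exact: measurable_funX.
have mr : measurable_fun setT (fun w => (57 * s ^+ 4) * normal_ratio s 0 (2 * s) (U w)).
  apply: measurable_funM => //; apply: measurable_funM => //; apply: measurableT_comp => //.
  by apply: measurable_funB; apply: measurable_funM => //; apply: measurable_funX => //;
    exact: measurable_funB.
have r0 x : 0 <= normal_ratio s 0 (2 * s) x.
  by rewrite mulr_ge0 ?expR_ge0// divr_ge0 ?ltW.
apply: (@le_trans _ _ (\int[P]_w ((57 * s ^+ 4) * normal_ratio s 0 (2 * s) (U w))%:E)%E).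
  apply: ge0_le_integral => //.
  - by move=> w _; rewrite lee_fin exprn_even_ge0.
  - exact/measurable_EFinP.
  - exact/measurable_EFinP.
  move=> w _; rewrite lee_fin /normal_ratio subr0.
  set x := U w; set z := x ^+ 2 / (s ^+ 2).
  (* The exponent 3z/8 is split into equal halves: exp(t) >= t at t = 3z/16, once squared, controls
     z^2. *)
  have -> : x ^+ 2 / (s ^+ 2 *+ 2) - x ^+ 2 / ((2 * s) ^+ 2 *+ 2) = 3 / 16 * z + 3 / 16 * z.
    by rewrite /z; field; rewrite gt_eqF.
  have z0 : 0 <= z by rewrite divr_ge0 ?sqr_ge0.
  have e0 : 3 / 16 * z <= expR (3 / 16 * z).
    by apply: le_trans (expR_ge1Dx _); rewrite lerDr.
  have -> : x ^+ 4 = z ^+ 2 * s ^+ 4.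
    by rewrite /z; field; rewrite gt_eqF.
  rewrite expRD; set y := expR _ in e0 *.
  have -> : 57 * s ^+ 4 * (s / (2 * s) * (y * y)) = 57 / 2 * (y * y) * s ^+ 4.
    by field; rewrite gt_eqF.
  apply: ler_wpM2r; first by rewrite exprn_ge0 ?ltW.
  have : (3 / 16 * z) ^+ 2 <= y * y by rewrite expr2 ler_pM// mulr_ge0.
  have -> : (3 / 16 * z) ^+ 2 = 9 / 256 * z ^+ 2 by field.
  by have := sqr_ge0 z; lra.
under eq_integral do rewrite EFinM.
rewrite ge0_integralZl_EFin//.
- by rewrite integral_normal_ratio// mule1.
- by move=> w _; rewrite lee_fin.
- apply/measurable_EFinP; apply: measurable_funM => //; apply: measurableT_comp => //.
  by apply: measurable_funB; apply: measurable_funM => //; apply: measurable_funX => //;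
    exact: measurable_funB.
- by rewrite mulr_ge0// exprn_ge0// ltW.
Qed.


Lemma integrable_normal_pow (n : nat) : (n <= 4)%N ->
  P.-integrable setT (fun w => (U w ^+ n)%:E).
Proof.
move=> n4; apply: (@le_integrable _ _ _ _ _ measurableT _
    (fun w => (1 + U w ^+ 4)%:E)).
- by apply/measurable_EFinP; exact: measurable_funX.
- move=> w _; rewrite lee_fin normrX (@ger0_norm _ (1 + _)); last first.
    by rewrite addr_ge0 ?exprn_even_ge0.
  rewrite -(@ger0_norm _ (U w ^+ 4)) ?exprn_even_ge0// normrX.
  have [x1|x1] := leP `|U w| 1.
    by apply: (@le_trans _ _ 1); [exact: exprn_ile1|rewrite lerDl exprn_ge0].
  by rewrite (le_trans (ler_weXn2l (ltW x1) n4))// lerDr.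
- apply/integrableP; split.
    by apply/measurable_EFinP; apply: measurable_funD => //; exact: measurable_funX.
  under eq_integral do rewrite gee0_abs ?lee_fin ?addr_ge0 ?exprn_even_ge0// EFinD.
  rewrite ge0_integralD//; first last.
  - by apply/measurable_EFinP; exact: measurable_funX.
  - by move=> w _; rewrite lee_fin exprn_even_ge0.
  rewrite integral_cst// mul1e [X in (X + _)%E]probability_setT lte_add_pinfty ?ltry//.
  by rewrite (le_lt_trans normal_fourth_moment)// ltry.
Qed.

Let E1 := \int[P]_w U w.
Let E2 := \int[P]_w U w ^+ 2.

(* E[ratio] = 1 and exp z >= 1 + z give one inequality between the first two
   moments for each (m, u); letting (m, u) vary around (0, s) determines both. *)
Let normal_ratio_moments (m u : R) : 0 < u ->
  1 + ((s ^- 2 - u ^- 2) / 2 * E2 + m / u ^+ 2 * E1 - m ^+ 2 / (u ^+ 2 *+ 2)) <= u / s.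
Proof.
move=> u0.
set a := (s ^- 2 - u ^- 2) / 2; set b := m / u ^+ 2; set c := m ^+ 2 / (u ^+ 2 *+ 2).
have i2 := @integrable_normal_pow 2 isT.
have i1 : P.-integrable setT (fun w => (U w)%:E) := @integrable_normal_pow 1 isT.
have ia : P.-integrable setT (fun w => (a * U w ^+ 2)%:E).
  by under eq_fun do rewrite EFinM; exact: integrableZl.
have ib : P.-integrable setT (fun w => (b * U w)%:E).
  by under eq_fun do rewrite EFinM; exact: integrableZl.
have iab : P.-integrable setT (fun w => (a * U w ^+ 2 + b * U w)%:E).
  by under eq_fun do rewrite EFinD; exact: integrableD.
have ic : P.-integrable setT (fun w => (1 - c)%:E).
  exact: finite_measure_integrable_cst.
have <- : \int[P]_w (a * U w ^+ 2 + b * U w + (1 - c)) =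
    1 + (a * E2 + b * E1 - c).
  rewrite RintegralD// RintegralD// !RintegralZl// Rintegral_cst//.
  have -> : fine (P setT) = 1 by rewrite probability_setT.
  by rewrite /E1 /E2; ring.
have mr : measurable_fun setT (fun w => normal_ratio s m u (U w)).
  rewrite /normal_ratio; apply: measurable_funM => //; apply: measurableT_comp => //.
  by apply: measurable_funB; apply: measurable_funM => //; apply: measurable_funX => //;
    exact: measurable_funB.
have ir : P.-integrable setT (fun w => (normal_ratio s m u (U w))%:E).
  apply/integrableP; split; first exact/measurable_EFinP.
  have r0 x : 0 <= normal_ratio s m u x.
    by rewrite mulr_ge0 ?expR_ge0// divr_ge0 ?ltW.
  under eq_integral do rewrite gee0_abs ?lee_fin ?r0//.
  by rewrite integral_normal_ratio// ltry.
apply: (@le_trans _ _ (\int[P]_w (u / s * normal_ratio s m u (U w)))).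
  apply: le_Rintegral => //.
  - by rewrite /comp; under eq_fun do rewrite EFinD; exact: integrableD.
  - by rewrite /comp; under eq_fun do rewrite EFinM; exact: integrableZl.
  move=> w _; rewrite /normal_ratio mulrA.
  have -> : u / s * (s / u) = 1 by field; rewrite !gt_eqF.
  rewrite mul1r; apply: le_trans (expR_ge1Dx _); rewrite le_eqVlt; apply/orP; left; apply/eqP.
  by rewrite /a /b /c; field; rewrite !gt_eqF.
rewrite RintegralZl// [X in _ * X](_ : _ = 1) ?mulr1//.
by rewrite /Rintegral integral_normal_ratio.
Qed.

(** At m = [E1] and u = s the second-moment term drops out and the inequality becomes E1^2 / (2 s^2)
    <= 0. *)
Lemma normal_mean : \int[P]_w U w = 0.
Proof.
rewrite -/E1; have := normal_ratio_moments E1 s0.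
rewrite subrr mul0r mul0r add0r divff ?gt_eqF// gerDl.
have -> : E1 / s ^+ 2 * E1 - E1 ^+ 2 / (s ^+ 2 *+ 2) = E1 ^+ 2 * (s ^+ 2 *+ 2)^-1.
  by field; rewrite gt_eqF.
rewrite pmulr_lle0 ?invr_gt0 ?pmulrn_lgt0 ?exprn_gt0//.
by move=> E1_le0; apply/eqP; rewrite -sqrf_eq0 eq_le E1_le0 sqr_ge0.
Qed.

(** At m = 0 and u = v s the inequality reads (v^2 - 1) k <= 2 v^2 (v - 1) with k = E2 / s^2.
    Dividing by v - 1 and letting v tend to 1 from above gives k <= 1, and from below k >= 1. *)
Lemma normal_second_moment : \int[P]_w U w ^+ 2 = s ^+ 2.
Proof.
rewrite -/E2; have E2_ge0 : 0 <= E2 by apply: Rintegral_ge0 => w _; exact: sqr_ge0.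
pose k := E2 / s ^+ 2; suff : k = 1.
  by move/(congr1 ( *%R^~ (s ^+ 2))); rewrite /k mulfVK ?mul1r// gt_eqF// exprn_gt0.
have k_ge0 : 0 <= k by rewrite divr_ge0 ?sqr_ge0.
have kv v : 0 < v -> (v ^+ 2 - 1) * k <= (v - 1) * (2 * v ^+ 2).
  move=> v0; have vs0 : 0 < v * s by rewrite mulr_gt0.
  have := normal_ratio_moments 0 vs0.
  rewrite mul0r mul0r expr0n/= mul0r subr0 addr0.
  have -> : (s ^- 2 - (v * s) ^- 2) / 2 * E2 = (v ^+ 2 - 1) * k / (2 * v ^+ 2).
    by rewrite /k; field; rewrite !gt_eqF.
  rewrite mulfK ?gt_eqF// -lerBrDl ler_pdivrMr ?mulr_gt0 ?exprn_gt0//.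
apply/eqP; rewrite eq_le; apply/andP; split; apply/ler_addgt0Pr => e e0.
(* For t <= 1, (1 + t)^2 <= 1 + 3t <= 1 + e. In the mirror case below, t <= 1/2 keeps v = 1 - t
   positive. *)
- pose t := Num.min 1 (e / 3).
  have t0 : 0 < t by rewrite lt_min ltr01 divr_gt0.
  have t1 : t <= 1 by rewrite ge_min lexx.
  have te : t <= e / 3 by rewrite ge_min lexx orbT.
  have : (2 + t) * k <= 2 * (1 + t) ^+ 2.
    rewrite -(ler_pM2l t0); have := kv (1 + t) (addr_gt0 ltr01 t0).
    by congr (_ <= _); ring.
  nra.
- pose t := Num.min (1 / 2) (e / 3).
  have t0 : 0 < t by rewrite lt_min !divr_gt0.
  have t1 : t <= 1 / 2 by rewrite ge_min lexx.
  have te : t <= e / 3 by rewrite ge_min lexx orbT.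
  have : 2 * (1 - t) ^+ 2 <= (2 - t) * k.
    rewrite -(ler_pM2l t0); have := kv (1 - t); rewrite subr_gt0.
    have -> : t < 1 by lra.
    by move=> /(_ isT); rewrite -lerN2; congr (_ <= _); ring.
  nra.
Qed.

End normal_moments.

(** * Independence and covariation of Wiener processes *)

Section independence.
Context {R : realType} d (T : measurableType d) (P : probability T R).

Definition indep_rv (U V : T -> R) : Prop :=
  forall A B : set R, measurable A -> measurable B ->
    P (U @^-1` A `&` V @^-1` B) = (P (U @^-1` A) * P (V @^-1` B))%E.

Lemma indep_rv_comp (U V : T -> R) (f g : R -> R) :
  measurable_fun setT f -> measurable_fun setT g -> indep_rv U V ->
  indep_rv (f \o U) (g \o V).
Proof.
move=> mf mg UV A B mA mB; apply: (UV (f @^-1` A) (g @^-1` B)).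
- by rewrite -[X in measurable X]setTI; exact: mf.
- by rewrite -[X in measurable X]setTI; exact: mg.
Qed.

Section product_rule.
Variables (U V : T -> R).
Hypotheses (mU : measurable_fun setT U) (mV : measurable_fun setT V).
Hypothesis (UV : indep_rv U V).
Hypotheses (iU : P.-integrable setT (EFin \o U)) (iV : P.-integrable setT (EFin \o V)).

Let X : {RV P >-> R} := mfun_Sub (mem_set mU).
Let Y : {RV P >-> R} := mfun_Sub (mem_set mV).
Let mXY : measurable_fun setT (fun w => (U w, V w)) := measurable_fun_pair mU mV.
Let XY : {RV P >-> (R * R)%type} := mfun_Sub (mem_set mXY).

(** Independence is equality on rectangles, and rectangles determine the product measure; the
    product rules are then Tonelli and Fubini. *)
Let dXY (A : set (R * R)) : measurable A ->
  (distribution P X \x distribution P Y)%E A = distribution P XY A.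
Proof.
by move=> mA; apply: product_measure_unique => // B C mB mC; exact: UV.
Qed.

Let int_dXY (f : R * R -> \bar R) :
  (\int[distribution P X \x distribution P Y]_z f z = \int[distribution P XY]_z f z)%E.
Proof. by apply: eq_measure_integral => A mA _; exact: dXY. Qed.

Let mmul : measurable_fun setT (fun z : R * R => (z.1 * z.2)%:E).
Proof. by apply/measurable_EFinP; apply: measurable_funM. Qed.

(** First moments suffice here: Tonelli factors E|UV| into E|U| E|V|. *)
Lemma integrable_indepM : P.-integrable setT (fun w => (U w * V w)%:E).
Proof.
apply/integrableP; split.
  by apply/measurable_EFinP; exact: measurable_funM.
have mabs : measurable_fun setT (fun z : R * R => `|(z.1 * z.2)%:E|%E).
  exact: measurableT_comp.
have mn : measurable_fun setT (fun x : R => `|x|%:E).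
  by apply/measurable_EFinP; exact: normr_measurable.
have := @ge0_integral_distribution _ _ _ _ _ P XY _ mabs (fun=> abse_ge0 _).
rewrite /comp/= => <-; rewrite -int_dXY fubini_tonelli1//.
rewrite /fubini_F/=.
under eq_integral => x _.
  under eq_integral => y _ do rewrite normrM EFinM.
  rewrite ge0_integralZl//.
  over.
rewrite ge0_integralZr//; last exact: integral_ge0.
rewrite !ge0_integral_distribution//.
have [_ U_lty] := integrableP _ _ _ iU; have [_ V_lty] := integrableP _ _ _ iV.
have n0 (W : T -> R) : (0 <= \int[P]_w (`|W w|)%:E)%E.
  by apply: integral_ge0 => w _; rewrite lee_fin.
by apply: lte_mul_pinfty; [exact: n0|rewrite ge0_fin_numE//; exact: n0|].
Qed.

Lemma Rintegral_indepM :
  \int[P]_w (U w * V w) = \int[P]_w U w * \int[P]_w V w.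
Proof.
have iUV := integrable_indepM.
have fU := integrable_fin_num measurableT iU.
have fV := integrable_fin_num measurableT iV.
have key : (\int[P]_w (U w * V w)%:E = \int[P]_w (U w)%:E * \int[P]_w (V w)%:E)%E.
  rewrite -[LHS](@integral_distribution _ _ _ _ _ P XY (fun z => (z.1 * z.2)%:E))//.
  rewrite -int_dXY -integral12_prod_meas1//; last first.
    apply/integrableP; split => //.
    rewrite int_dXY ge0_integral_distribution//; last exact: measurableT_comp.
    by move/integrableP : iUV => [].
  rewrite /fubini_F/=.
  have iY : (distribution P Y).-integrable setT (fun y => y%:E).
    apply/integrableP; split; first exact/measurable_EFinP.
    rewrite ge0_integral_distribution//; last exact: measurableT_comp.
    by move/integrableP : iV => [].
  have iX : (distribution P X).-integrable setT (fun y => y%:E).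
    apply/integrableP; split; first exact/measurable_EFinP.
    rewrite ge0_integral_distribution//; last exact: measurableT_comp.
    by move/integrableP : iU => [].
  under eq_integral => x _.
    under eq_integral => y _ do rewrite EFinM.
    rewrite integralZl//.
    over.
  have EY : (\int[distribution P Y]_y y%:E = \int[P]_w (V w)%:E)%E.
    by rewrite integral_distribution//; exact/measurable_EFinP.
  have EX : (\int[distribution P X]_y y%:E = \int[P]_w (U w)%:E)%E.
    by rewrite integral_distribution//; exact/measurable_EFinP.
  rewrite EY -(fineK fV).
  rewrite integralZr// EX//.
by rewrite /Rintegral key fineM.
Qed.

End product_rule.
End independence.

Section orthogonal_sums.
Context {R : realType} d (T : measurableType d) (P : probability T R).
Variable (Y : nat -> T -> R).
Hypothesis iY : forall i j, (0 < i)%N -> (0 < j)%N ->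
  P.-integrable setT (fun w => (Y i w * Y j w)%:E).
Hypothesis oY : forall i j, (0 < i < j)%N -> \int[P]_w (Y i w * Y j w) = 0.
Variable C : R.
Hypothesis bY : forall i, (0 < i)%N -> \int[P]_w (Y i w ^+ 2) <= C.

Let S n w := \sum_(1 <= i < n.+1) Y i w.

Let SS n w : S n.+1 w = S n w + Y n.+1 w.
Proof. by rewrite /S big_nat_recr. Qed.

Let iSY n m : (0 < m)%N -> P.-integrable setT (fun w => (S n w * Y m w)%:E).
Proof.
move=> m0; elim: n => [|n IH].
  rewrite /S; under eq_fun do rewrite big_geq// mul0r; exact: integrable0.
under eq_fun do rewrite SS mulrDl EFinD; apply: integrableD => //; exact: iY.
Qed.

Let oSY n m : (n < m)%N -> \int[P]_w (S n w * Y m w) = 0.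
Proof.
elim: n => [|n IH] nm.
  rewrite /S; under eq_Rintegral do rewrite big_geq// mul0r.
  by rewrite Rintegral_cst// mul0r.
have m0 := ltn_trans (ltn0Sn n) nm.
under eq_Rintegral do rewrite SS mulrDl.
rewrite RintegralD//; [|exact: iSY|exact: iY].
by rewrite IH ?(ltnW nm)// oY ?add0r.
Qed.

Let iSS n : P.-integrable setT (fun w => (S n w ^+ 2)%:E).
Proof.
elim: n => [|n IH].
  rewrite /S; under eq_fun do rewrite big_geq// expr0n; exact: integrable0.
have i2 : P.-integrable setT (fun w => (2 * (S n w * Y n.+1 w))%:E).
  by under eq_fun do rewrite EFinM; apply: integrableZl => //; exact: iSY.
under eq_fun do rewrite SS sqrrD -mulr_natl !EFinD.
apply: integrableD => //; first exact: integrableD.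
by under eq_fun do rewrite expr2; exact: iY.
Qed.

(** Pythagoras by induction: the new term is orthogonal to the partial sum, so each index adds at
    most [C]. *)
Lemma orthogonal_sum_L2 n :
  P.-integrable setT (fun w => ((\sum_(1 <= i < n.+1) Y i w) ^+ 2)%:E) /\
  \int[P]_w ((\sum_(1 <= i < n.+1) Y i w) ^+ 2) <= n%:R * C.
Proof.
split; first exact: iSS.
rewrite [leLHS](_ : _ = \int[P]_w (S n w ^+ 2))//.
elim: n => [|n IH].
  under eq_Rintegral do rewrite /S big_geq// expr0n.
  by rewrite Rintegral_cst// !mul0r.
have i2 : P.-integrable setT (fun w => (2 * (S n w * Y n.+1 w))%:E).
  by under eq_fun do rewrite EFinM; apply: integrableZl => //; exact: iSY.
have i3 : P.-integrable setT (fun w => (Y n.+1 w ^+ 2)%:E).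
  by under eq_fun do rewrite expr2; exact: iY.
under eq_Rintegral do rewrite SS sqrrD -mulr_natl.
rewrite RintegralD//; last by rewrite /comp; under eq_fun do rewrite EFinD; exact: integrableD.
rewrite RintegralD//; last exact: iSS.
rewrite RintegralZl ?oSY//; last exact: iSY.
rewrite mulr0 addr0 -natr1 mulrDl mul1r lerD//.
exact: bY.
Qed.

End orthogonal_sums.

Section sigma_gen.
Context {R : realType} d (T : measurableType d) (I : Type) (D : set I) (X : I -> T -> R).

Let G := \bigcup_(i in D) preimage_set_system setT (X i) measurable.
Let TG := g_sigma_algebraType G.

(** Stated as measurability on a copy of [T] carrying the generated sigma-algebra, so that the
    closure properties of [measurable_fun] apply to events of the past. *)
Definition sigma_gen_measurable (U : T -> R) :=
  measurable_fun [set: TG] (U : TG -> R).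

Lemma sigma_gen_measurable_gen i : D i -> sigma_gen_measurable (X i).
Proof.
move=> Di _ A mA; apply: sub_sigma_algebra.
by exists i => //; exists A.
Qed.

Lemma sigma_gen_preimage U A : sigma_gen_measurable U -> measurable A ->
  sigma_gen D X (U @^-1` A).
Proof. by move=> mU mA; rewrite -[X in sigma_gen _ _ X]setTI; apply: mU. Qed.

End sigma_gen.
Arguments sigma_gen_measurable {R d T I} D X U.

Section quadratic_variation.
Context {R : realType} d (T : measurableType d) (P : probability T R).

(** Since [0.-1 = 0], the increment of index 0 vanishes; genuine increments start at index 1. *)
Definition incr (Z : R -> T -> R) (h : R) (i : nat) (w : T) : R :=
  Z (i%:R * h) w - Z (i.-1%:R * h) w.

Section increments.
Variable (Z : R -> T -> R) (wZ : wiener1 P Z).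
Variables (h : R) (h0 : 0 < h).

Let t_ge0 i : 0 <= i%:R * h. Proof. by rewrite mulr_ge0// ltW. Qed.

Lemma measurable_incr i : measurable_fun setT (incr Z h i).
Proof. by have [mZ _ _ _ _] := wZ; apply: measurable_funB; apply: mZ. Qed.

Let t_lt i : (0 < i)%N -> i.-1%:R * h < i%:R * h.
Proof. by case: i => // i _; rewrite ltr_pM2r// ltr_nat. Qed.

Lemma incr_law i (A : set R) : (0 < i)%N -> measurable A ->
  P (incr Z h i @^-1` A) = normal_prob 0 (Num.sqrt h) A.
Proof.
move=> i1 mA; have [_ _ _ law _] := wZ; rewrite (law _ _ (t_ge0 _) (t_lt i1) _ mA).
suff -> : i%:R * h - i.-1%:R * h = h by [].
by case: i i1 => // i _; rewrite -mulrBl -natr1 addrC addKr mul1r.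
Qed.

Lemma incr_sigma_gen (D : set R) i : D (i%:R * h) -> D (i.-1%:R * h) ->
  sigma_gen_measurable D Z (incr Z h i).
Proof. by move=> Di Di1; apply: measurable_funB; exact: sigma_gen_measurable_gen. Qed.

(** Increment i is determined by the path up to time (j - 1) h, and increment j is independent of
    that past. *)
Lemma incr_indep i j : (0 < i < j)%N -> indep_rv P (incr Z h i) (incr Z h j).
Proof.
move=> /andP[i1 ij] A B mA mB; have [_ _ _ _ ind] := wZ.
apply: (ind _ _ (t_ge0 j.-1)) => //; first by apply: t_lt; exact: leq_ltn_trans ij.
apply: sigma_gen_preimage => //; apply: incr_sigma_gen;
  rewrite /= in_itv/= t_ge0/= ler_pM2r// ler_nat; lia.
Qed.

Lemma incr_moments i : (0 < i)%N ->
  [/\ forall n, (n <= 4)%N -> P.-integrable setT (fun w => (incr Z h i w ^+ n)%:E),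
      \int[P]_w incr Z h i w = 0,
      \int[P]_w (incr Z h i w ^+ 2) = h &
      \int[P]_w (incr Z h i w ^+ 4) <= 57 * h ^+ 2].
Proof.
move=> i1; have s0 : 0 < Num.sqrt h by rewrite sqrtr_gt0.
have law A := @incr_law i A i1; have mI := measurable_incr i.
have int n : (n <= 4)%N -> P.-integrable setT (fun w => (incr Z h i w ^+ n)%:E).
  exact: (integrable_normal_pow mI s0 law).
split => //.
- exact: (normal_mean mI s0 law).
- by rewrite (normal_second_moment mI s0 law) sqr_sqrtr// ltW.
- rewrite -lee_fin fineK; last exact: (integrable_fin_num measurableT (int 4 _)).
  rewrite (le_trans (normal_fourth_moment mI s0 law))// lee_fin.
  by rewrite -[4%N]/(2 * 2)%N exprM sqr_sqrtr ?(ltW h0).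
Qed.

End increments.

Lemma integrable_mul_of_sqr (U V : T -> R) :
  measurable_fun setT U -> measurable_fun setT V ->
  P.-integrable setT (fun w => (U w ^+ 2)%:E) ->
  P.-integrable setT (fun w => (V w ^+ 2)%:E) ->
  P.-integrable setT (fun w => (U w * V w)%:E).
Proof.
move=> mU mV iU iV; apply: (@le_integrable _ _ _ _ _ measurableT _
    (fun w => (U w ^+ 2 + V w ^+ 2)%:E)).
- by apply/measurable_EFinP; exact: measurable_funM.
- move=> w _; rewrite lee_fin (@ger0_norm _ (_ + _)) ?addr_ge0 ?sqr_ge0//.
  rewrite ler_norml; apply/andP; split; nra.
- by under eq_fun do rewrite EFinD; exact: integrableD.
Qed.

Section covariation.
Variables (Z Z' : R -> T -> R) (wZ : wiener1 P Z) (wZ' : wiener1 P Z').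
Variables (same : bool) (h : R).
Hypothesis h0 : 0 < h.
Hypothesis same_Z : same -> Z = Z'.
Hypothesis indep_Z : ~~ same -> forall A B,
  sigma_gen `[0, +oo[ Z A -> sigma_gen `[0, +oo[ Z' B -> P (A `&` B) = (P A * P B)%E.

(** The Boolean distinguishes quadratic variation from covariation, so that one bound serves both;
    [same%:R * h] is the mean of the product of increments. *)
Let Y i w := incr Z h i w * incr Z' h i w - same%:R * h.

Let mY i : measurable_fun setT (Y i).
Proof.
by apply: measurable_funB => //; apply: measurable_funM; exact: measurable_incr.
Qed.

Let indep_of_gen (U V : T -> R) : ~~ same ->
  sigma_gen_measurable `[0, +oo[ Z U -> sigma_gen_measurable `[0, +oo[ Z' V -> indep_rv P U V.
Proof. by move=> s mU mV A B mA mB; apply: indep_Z => //; exact: sigma_gen_preimage. Qed.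

Let gen_incr (z : R -> T -> R) i : sigma_gen_measurable `[0, +oo[ z (incr z h i).
Proof. by apply: incr_sigma_gen; rewrite /= in_itv/= mulr_ge0// ltW. Qed.

(** On the diagonal the second moment is the fourth moment of an increment minus h^2; off the
    diagonal it is exactly h^2. *)
Let YY i : (0 < i)%N -> P.-integrable setT (fun w => (Y i w ^+ 2)%:E) /\
  \int[P]_w (Y i w ^+ 2) <= 57 * h ^+ 2.
Proof.
move=> i0; have [iZ mean varZ fourth] := incr_moments wZ h0 i0.
have [iZ' _ varZ' _] := incr_moments wZ' h0 i0.
have [s|s] := boolP same.
  have s1 : same%:R = 1 :> R by rewrite s.
  have {}iZ2 := iZ 2 isT; have {}iZ4 := iZ 4 isT.
  have YE w : Y i w ^+ 2 = incr Z h i w ^+ 4 - 2 * h * incr Z h i w ^+ 2 + h ^+ 2.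
    by rewrite /Y -(same_Z s) s1; ring.
  have iZ2' : P.-integrable setT (fun w => (2 * h * incr Z h i w ^+ 2)%:E).
    by under eq_fun do rewrite EFinM; exact: integrableZl.
  have ih : P.-integrable setT (fun w => (h ^+ 2)%:E).
    exact: finite_measure_integrable_cst.
  have iB : P.-integrable setT (fun w => (incr Z h i w ^+ 4 - 2 * h * incr Z h i w ^+ 2)%:E).
    by under eq_fun do rewrite EFinB; exact: integrableB.
  split; first by under eq_fun do rewrite YE EFinD; exact: integrableD.
  under eq_Rintegral do rewrite YE.
  rewrite RintegralD// RintegralB// RintegralZl// varZ Rintegral_cst//.
  have -> : fine (P setT) = 1 by rewrite probability_setT.
  by have := sqr_ge0 h; lra.
have s0 : same%:R = 0 :> R by rewrite (negbTE s).
have YE w : Y i w ^+ 2 = incr Z h i w ^+ 2 * incr Z' h i w ^+ 2.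
  by rewrite /Y s0; ring.
have ind : indep_rv P (fun w => incr Z h i w ^+ 2) (fun w => incr Z' h i w ^+ 2).
  by apply: indep_of_gen => //; apply: measurable_funX; exact: gen_incr.
have mX z : wiener1 P z -> measurable_fun setT (fun w => incr z h i w ^+ 2).
  by move=> wz; apply: measurable_funX; exact: measurable_incr.
split.
  under eq_fun do rewrite YE.
  exact: (integrable_indepM (mX _ wZ) (mX _ wZ') ind (iZ 2 isT) (iZ' 2 isT)).
under eq_Rintegral do rewrite YE.
rewrite (Rintegral_indepM (mX _ wZ) (mX _ wZ') ind (iZ 2 isT) (iZ' 2 isT)).
by rewrite varZ varZ'; have := sqr_ge0 h; lra.
Qed.

Let oY i j : (0 < i < j)%N -> \int[P]_w (Y i w * Y j w) = 0.
Proof.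
move=> ij; have [i0 j0] : (0 < i /\ 0 < j)%N by lia.
have [iZi meani vari _] := incr_moments wZ h0 i0.
have [iZj meanj varj _] := incr_moments wZ h0 j0.
have mI z k : wiener1 P z -> measurable_fun setT (incr z h k).
  by move=> wz; exact: measurable_incr.
have [s|s] := boolP same.
  have s1 : same%:R = 1 :> R by rewrite s.
  (* On the diagonal each [Y k] is a centered function of a single increment, and the increments i
     and j are independent. *)
  pose g (x : R) := x ^+ 2 - h.
  have mg : measurable_fun setT g by apply: measurable_funB => //; exact: measurable_funX.
  have YE k : Y k = g \o incr Z h k.
    by apply/funext => w; rewrite /Y -(same_Z s) s1 mul1r -expr2.
  have ig k : (0 < k)%N -> P.-integrable setT (EFin \o (g \o incr Z h k)).
    move=> k0; have [iZk _ _ _] := incr_moments wZ h0 k0.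
    rewrite /comp /g; under eq_fun do rewrite EFinB.
    apply: integrableB => //; first exact: (iZk 2 isT).
    exact: finite_measure_integrable_cst.
  have Eg k : (0 < k)%N -> \int[P]_w (g \o incr Z h k) w = 0.
    move=> k0; have [iZk _ vark _] := incr_moments wZ h0 k0.
    rewrite /comp /g RintegralB//; [|exact: (iZk 2 isT)|exact: finite_measure_integrable_cst].
    rewrite vark Rintegral_cst//.
    have -> : fine (P setT) = 1 by rewrite probability_setT.
    by rewrite mulr1 subrr.
  rewrite !YE (Rintegral_indepM _ _ (indep_rv_comp mg mg (incr_indep wZ h0 ij)))//.
  - by rewrite Eg// mul0r.
  - by apply: measurableT_comp => //; exact: mI.
  - by apply: measurableT_comp => //; exact: mI.
  - exact: ig.
  - exact: ig.
have s0 : same%:R = 0 :> R by rewrite (negbTE s).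
(* The four factors are regrouped by process instead of by time: independence of [Z] and [Z'] splits
   the mean, and the [Z] part vanishes because its two increments are independent and centered. *)
have YE w : Y i w * Y j w = (incr Z h i w * incr Z h j w) * (incr Z' h i w * incr Z' h j w).
  by rewrite /Y s0; ring.
under eq_Rintegral do rewrite YE.
have mM z : wiener1 P z -> measurable_fun setT (fun w => incr z h i w * incr z h j w).
  by move=> wz; apply: measurable_funM; exact: mI.
have iM z : wiener1 P z -> P.-integrable setT (fun w => (incr z h i w * incr z h j w)%:E).
  move=> wz; apply: integrable_mul_of_sqr; try exact: mI.
    by have [+ _ _ _] := incr_moments wz h0 i0; apply.
  by have [+ _ _ _] := incr_moments wz h0 j0; apply.
rewrite (Rintegral_indepM (mM _ wZ) (mM _ wZ'))//; last 3 first.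
- by apply: indep_of_gen => //; apply: measurable_funM; exact: gen_incr.
- exact: iM.
- exact: iM.
rewrite (Rintegral_indepM (mI _ _ wZ) (mI _ _ wZ) (incr_indep wZ h0 ij)); last 2 first.
- exact: (iZi 1 isT).
- exact: (iZj 1 isT).
by rewrite meani !mul0r.
Qed.

Lemma covariation_L2 n :
  P.-integrable setT (fun w => ((\sum_(1 <= i < n.+1) Y i w) ^+ 2)%:E) /\
  \int[P]_w ((\sum_(1 <= i < n.+1) Y i w) ^+ 2) <= n%:R * (57 * h ^+ 2).
Proof.
apply: orthogonal_sum_L2 => //; last by move=> i /YY[].
by move=> i j /YY[i2 _] /YY[j2 _]; exact: integrable_mul_of_sqr.
Qed.

End covariation.

End quadratic_variation.

(** * Drift increments *)

Section caratheodory.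
Context {R : realType} d (T : measurableType d).

(* psi is the pointwise limit of its samples on the grid of mesh 1/n. *)
Lemma measurable_caratheodory (psi : R -> T -> R) :
  (forall u, 0 <= u -> measurable_fun setT (psi u)) ->
  (forall w, continuous (psi ^~ w)) ->
  measurable_fun setT (fun z : measurableTypeR R * T => psi (Num.max z.1 0) z.2).
Proof.
move=> mpsi cpsi.
(* [Num.truncn] is 0 on negative reals, so the grid point approximates [Num.max u 0] rather than u,
   from below and within 1/(n+1). *)
pose g (n : nat) (u : R) : R := (Num.truncn (n.+1%:R * u))%:R / n.+1%:R.
apply: (@measurable_fun_cvg _ _ _ _ (fun n z => psi (g n z.1) z.2)).
  move=> n _ A mA; rewrite setTI.
  rewrite [X in measurable X](_ : _ = \bigcup_k
      ([set u : measurableTypeR R | Num.truncn (n.+1%:R * u) = k]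
        `*` (psi (k%:R / n.+1%:R) @^-1` A))); last first.
    apply/seteqP; split => [[u w]/= Auw|[u w]/= [k _ [/= <-]]]; last exact.
    by exists (Num.truncn (n.+1%:R * u)).
  apply: bigcup_measurable => k _; apply: measurableX; last first.
    by rewrite -[X in measurable X]setTI; apply: mpsi => //; rewrite divr_ge0.
  (* Cell 0 also contains every negative u and is a half-line; the other cells are half-open
     intervals. *)
  case: k => [|k].
    rewrite [X in measurable X](_ : _ = `]-oo, n.+1%:R^-1[%classic)//.
    have e (u : R) : (Num.truncn (n.+1%:R * u) <= 0)%N = (u < n.+1%:R^-1).
      by rewrite truncn_le_nat -ltr_pdivlMl// mulr1.
    apply/seteqP; split => u /=; rewrite in_itv/= -e leqn0; first by move=> ->.
    by move/eqP.
  rewrite [X in measurable X](_ : _ = `[k.+1%:R / n.+1%:R, k.+2%:R / n.+1%:R[%classic)//.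
  have e (u : R) : (k < Num.truncn (n.+1%:R * u) <= k.+1)%N =
      (k.+1%:R / n.+1%:R <= u < k.+2%:R / n.+1%:R).
    by rewrite truncn_gt_nat truncn_le_nat ler_pdivrMr// ltr_pdivlMr// mulrC.
  by apply/seteqP; split => u /=; rewrite in_itv/= -e; lia.
move=> [u0 w] _ /=; move: u0 => u.
suff gu : g n u @[n --> \oo] --> Num.max (u : R) 0.
  by apply: (@cvg_comp _ _ _ (g ^~ u) (psi ^~ w) _ (nbhs (Num.max (u : R) 0))) => //; exact: cpsi.
move: (u : R) => {}u.
have gd n : `|Num.max u 0 - g n u| <= n.+1%:R^-1.
  have [u0|u0] := leP u 0.
    rewrite /g (_ : Num.truncn _ = 0%N) ?mul0r ?subrr ?normr0//.
    apply/eqP; rewrite -leqn0 truncn_le_nat (@le_lt_trans _ _ 0)//.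
    by rewrite pmulr_rle0.
  have nu0 : 0 <= n.+1%:R * u by rewrite mulr_ge0// ltW.
  have /andP[g1 g2] := truncn_itv nu0.
  rewrite -[(Num.truncn _).+1%:R]natr1 in g2; rewrite /g; set t := (Num.truncn _)%:R in g1 g2 *.
  rewrite ger0_norm; last by rewrite subr_ge0 ler_pdivrMr// mulrC.
  by move: (ltW g2); rewrite mulrC -ler_pdivlMr// mulrDl mul1r addrC lerBlDr.
apply/cvgrPdist_le => e e0; near=> n; rewrite (le_trans (gd n))//.
rewrite ltW//; near: n; exact: (near_infty_natSinv_lt (PosNum e0)).
Unshelve. all: by end_near.
Qed.

(** Clamping time at 0 turns continuity on the half-line into continuity on all of [R], so that
    integrands are globally continuous. *)
Lemma continuous_max_of_within (f : R -> R) :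
  {within `[0, +oo[, continuous f} -> continuous (fun u : R => f (Num.max u 0)).
Proof.
move=> /subspace_continuousP cf x.
have m0 (y : R) : 0 <= Num.max y 0 by rewrite le_max lexx orbT.
have cm : (fun u : R => Num.max u 0) u @[u --> x] --> Num.max x 0.
  by apply: continuous_max => //; exact: cvg_cst.
have cw : (fun u : R => Num.max u 0) u @[u --> x] --> within `[0, +oo[ (nbhs (Num.max x 0)).
  move=> A wA; have nA : \forall u \near x, `[0, +oo[%classic (Num.max u 0) -> A (Num.max u 0).
    exact: cm wA.
  change (\forall u \near x, A (Num.max u 0)).
  by apply: filterS nA => u; apply; rewrite /= in_itv/= m0.
by apply: (cvg_comp _ f cw); apply: cf; rewrite /= in_itv/= m0.
Qed.
End caratheodory.

Section drift.
Context {R : realType}.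
Local Notation mu := (@lebesgue_measure R).

Lemma continuous_itv_integrable (g : R -> R) (s t : R) : continuous g ->
  mu.-integrable `[s, t] (EFin \o g).
Proof.
move=> cg; apply: continuous_compact_integrable; first exact: segment_compact.
exact: continuous_subspaceT.
Qed.

Lemma continuous_sqr (V : topologicalType) (g : V -> R) :
  continuous g -> continuous (fun u => g u ^+ 2).
Proof.
by move=> cg u; apply: (cvg_comp g (fun x => x ^+ 2)); [exact: cg|exact: sqr_continuous].
Qed.

(** With m the mean of g over [s, t], the integral of (g - m)^2 is nonnegative; multiplied by t - s,
    it is the difference of the two sides. *)
Lemma sqr_Rintegral_le (g : R -> R) (s t : R) : continuous g -> s < t ->
  (\int[mu]_(u in `[s, t]) g u) ^+ 2 <= (t - s) * \int[mu]_(u in `[s, t]) (g u ^+ 2).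
Proof.
move=> cg st; set I := \int[mu]_(u in _) g u; set J := \int[mu]_(u in _) _.
have ts0 : 0 < t - s by rewrite subr_gt0.
pose m := I / (t - s).
have cg2 : continuous (fun u => g u ^+ 2).
  exact: continuous_sqr.
have cmg : continuous (fun u => 2 * m * g u).
  by move=> u; apply: cvgM; [exact: cvg_cst|exact: cg].
have cb : continuous (fun u => g u ^+ 2 - 2 * m * g u).
  by move=> u; apply: cvgB; [exact: cg2|exact: cmg].
have : 0 <= \int[mu]_(u in `[s, t]) ((g u - m) ^+ 2).
  by apply: Rintegral_ge0 => u _; exact: sqr_ge0.
have gE u : (g u - m) ^+ 2 = g u ^+ 2 - 2 * m * g u + m ^+ 2 by ring.
under eq_Rintegral do rewrite gE.
rewrite RintegralD//; [|exact: continuous_itv_integrable..|]; last first.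
  by apply: continuous_itv_integrable; exact: cst_continuous.
rewrite RintegralB//; [|exact: continuous_itv_integrable..].
rewrite RintegralZl//; last exact: continuous_itv_integrable.
rewrite Rintegral_cst//.
have -> : fine (mu `[s, t]) = t - s by rewrite lebesgue_measure_itv/= lte_fin st.
rewrite -/I -/J /m.
rewrite -(pmulr_rge0 _ ts0).
have -> : (t - s) * (J - 2 * (I / (t - s)) * I + (I / (t - s)) ^+ 2 * (t - s)) =
    (t - s) * J - I ^+ 2 by field; rewrite gt_eqF.
by rewrite subr_ge0.
Qed.

Lemma Rintegral_itv_sub (g : R -> R) (s t : R) : continuous g -> 0 <= s -> s < t ->
  \int[mu]_(u in `[0, t]) g u - \int[mu]_(u in `[0, s]) g u = \int[mu]_(u in `[s, t]) g u.
Proof.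
move=> cg s0 st; rewrite Rintegral_itvB ?bnd_simp//; last 2 first.
- exact: continuous_itv_integrable.
- exact: ltW.
apply: Rintegral_itv_obnd_cbnd.
by apply: integrableS (continuous_itv_integrable s t cg) => //; exact: subset_itv_oc_cc.
Qed.

Context d (T : measurableType d) (P : probability T R).

(** Cauchy-Schwarz along each path yields one factor t - s; Tonelli followed by the uniform bound on
    the second moments yields the other. *)
Lemma drift_increment_L2 (psi : R -> T -> R) (K s t : R) (D : T -> R) :
  (forall u, measurable_fun setT (psi u)) -> (forall w, continuous (psi ^~ w)) ->
  (forall u, 0 <= u -> (\int[P]_w (psi u w ^+ 2)%:E <= K%:E)%E) ->
  0 <= s -> s < t -> measurable_fun setT D ->
  {ae P, forall w, D w = \int[mu]_(u in `[0, t]) psi u w - \int[mu]_(u in `[0, s]) psi u w} ->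
  (\int[P]_w (D w ^+ 2)%:E <= (K * (t - s) ^+ 2)%:E)%E.
Proof.
move=> mpsi cpsi psiK s0 st mD DE.
have ts0 : 0 < t - s by rewrite subr_gt0.
(* The clamp makes F jointly measurable on the whole product, and the indicator restricts it to
   [s, t], where the clamp is invisible because s >= 0. *)
pose F (z : measurableTypeR R * T) : \bar R :=
  (\1_(`[s, t]%classic : set R) z.1 * psi (Num.max z.1 0) z.2 ^+ 2)%:E.
have mF : measurable_fun setT F.
  apply/measurable_EFinP; apply: measurable_funM.
    by apply: measurableT_comp => //; exact: measurable_indic.
  apply: measurable_funX; exact: measurable_caratheodory.
have F0 z : (0 <= F z)%E by rewrite lee_fin mulr_ge0 ?sqr_ge0.
have Fin u w : u \in `[s, t] -> F (u, w) = (psi u w ^+ 2)%:E.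
  move=> ust; rewrite /F/= indicE mem_set// mul1r max_l//.
  by move: ust; rewrite in_itv/= => /andP[su _]; exact: le_trans su.
have Fout u w : u \notin `[s, t] -> F (u, w) = 0%E.
  by move=> ust; rewrite /F/= indicE memNset ?mul0r//; exact/negP.
have intF w : (\int[mu]_u F (u, w) = (\int[mu]_(u in `[s, t]) (psi u w ^+ 2))%:E)%E.
  rewrite fineK; last first.
    apply: integrable_fin_num => //; apply: continuous_itv_integrable.
    exact: continuous_sqr.
  rewrite [RHS]integral_mkcond; apply: eq_integral => u _; rewrite patchE.
  case: ifPn => [|/negP ust].
    by rewrite inE/= => ust; rewrite Fin.
  by rewrite Fout//; apply/negP => /mem_set.
have mI : measurable_fun setT (fun w => \int[mu]_u F (u, w))%E.
  exact: (measurable_fun_fubini_tonelli_G (m1 := mu) F mF F0).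
apply: (@le_trans _ _ (\int[P]_w ((t - s)%:E * \int[mu]_u F (u, w)))%E).
  apply: ae_ge0_le_integral => //.
  - by move=> w _; rewrite lee_fin sqr_ge0.
  - by apply/measurable_EFinP; exact: measurable_funX.
  - by move=> w _; apply: mule_ge0; [rewrite lee_fin ltW|apply: integral_ge0].
  - exact: emeasurable_funM.
  - apply: filterS DE => w DE _; rewrite intF -EFinM lee_fin DE Rintegral_itv_sub//.
    exact: sqr_Rintegral_le.
rewrite ge0_integralZl_EFin//; [|by move=> w _; apply: integral_ge0|exact: ltW].
rewrite -(fubini_tonelli (m1 := mu) (m2 := P) F mF F0).
have le_u : (\int[mu]_u \int[P]_w F (u, w) <= \int[mu]_(u in `[s, t]) K%:E)%E.
  rewrite [leRHS]integral_mkcond; apply: ge0_le_integral => //.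
  - by move=> u _; apply: integral_ge0.
  - exact: (measurable_fun_fubini_tonelli_F (m2 := P) F mF F0).
  - by apply/(measurable_restrictT _ _).1 => //.
  move=> u _; rewrite patchE; case: ifPn => [|/negP ust].
    rewrite inE/= => ust; under eq_integral do rewrite Fin//.
    by apply: psiK; move: ust; rewrite in_itv/= => /andP[su _]; exact: le_trans su.
  rewrite integral0_eq// => w _; rewrite Fout//; by apply/negP => /mem_set.
apply: le_trans (lee_wpmul2l _ le_u) _; first by rewrite lee_fin ltW.
rewrite integral_cst//= [X in (_ * (_ * X))%E](_ : _ = (t - s)%:E); last first.
  by rewrite [LHS]lebesgue_measure_itv/= lte_fin st.
by rewrite -!EFinM lee_fin mulrCA expr2.
Qed.
End drift.

(** * The weight matrix and the discrepancy *)

Section dot.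
Context {R : realType}.

Definition dotmx n (u v : 'cV[R]_n) : R := (u^T *m v) 0 0.

Lemma dotmxE n (u v : 'cV[R]_n) : dotmx u v = \sum_i u i 0 * v i 0.
Proof. by rewrite /dotmx mxE; apply: eq_bigr => i _; rewrite mxE. Qed.

Lemma dotmx_sqr n (u : 'cV[R]_n) : dotmx u u = \sum_i u i 0 ^+ 2.
Proof. by rewrite dotmxE; apply: eq_bigr => i _; rewrite expr2. Qed.

Lemma dotmx_ge0 n (u : 'cV[R]_n) : 0 <= dotmx u u.
Proof. by rewrite dotmx_sqr sumr_ge0// => i _; exact: sqr_ge0. Qed.

Lemma dotmx_eq0 n (u : 'cV[R]_n) : dotmx u u = 0 -> u = 0.
Proof.
rewrite dotmx_sqr => /eqP; rewrite psumr_eq0 => [/allP u0|i _]; last exact: sqr_ge0.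
apply/colP => i; rewrite mxE; apply/eqP; rewrite -sqrf_eq0.
by apply: u0; rewrite mem_index_enum.
Qed.

Lemma colB n (u v : 'cV[R]_n) i : (u - v) i 0 = u i 0 - v i 0.
Proof. by rewrite !mxE. Qed.

Lemma dotmxC n (u v : 'cV[R]_n) : dotmx u v = dotmx v u.
Proof. by rewrite !dotmxE; apply: eq_bigr => i _; rewrite mulrC. Qed.

Lemma sqr_coord_le_dotmx n (u : 'cV[R]_n) i : u i 0 ^+ 2 <= dotmx u u.
Proof. by rewrite dotmx_sqr (bigD1 i)//= lerDl sumr_ge0// => j _; exact: sqr_ge0. Qed.

(** The sum of the squares (a v_i - c u_i)^2 equals a (a b - c^2); a = 0 is split off because a has
    to be cancelled. *)
Lemma dotmx_cauchy n (u v : 'cV[R]_n) : dotmx u v ^+ 2 <= dotmx u u * dotmx v v.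
Proof.
set a := dotmx u u; set b := dotmx v v; set c := dotmx u v.
have a0 : 0 <= a by exact: dotmx_ge0.
have : 0 <= \sum_i (a * v i 0 - c * u i 0) ^+ 2.
  by apply: sumr_ge0 => i _; exact: sqr_ge0.
have -> : \sum_i (a * v i 0 - c * u i 0) ^+ 2 = a * (a * b - c ^+ 2).
  rewrite (eq_bigr (fun i => a ^+ 2 * v i 0 ^+ 2 + - (2 * a * c) * (u i 0 * v i 0)
      + c ^+ 2 * u i 0 ^+ 2)); last by move=> i _; ring.
  by rewrite !big_split/= -!mulr_sumr -!dotmx_sqr -dotmxE -/a -/b -/c; ring.
have [a_eq0 _|a_neq0] := eqVneq a 0.
  have u0 : u = 0 by exact: dotmx_eq0.
  by rewrite a_eq0 mul0r /c u0 dotmxE big1 ?expr0n// => i _; rewrite mxE mul0r.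
by rewrite pmulr_rge0 ?lt_def ?a_neq0// subr_ge0.
Qed.

Lemma unitmx_of_inj n (M : 'M[R]_n) :
  (forall v : 'cV[R]_n, M *m v = 0 -> v = 0) -> M \in unitmx.
Proof.
move=> injM; rewrite -unitmx_tr -row_free_unit; apply: inj_row_free => v.
move=> /(congr1 trmx); rewrite trmx_mul trmxK trmx0 => /injM /(congr1 trmx).
by rewrite trmxK trmx0.
Qed.

Section gram.
Context n m (B : 'M[R]_(n, m)) (E : 'M[R]_(m, n)) (BE : B *m E = 1%:M).
Let W := 2 *: (B *m B^T).

Let formE (u v : 'cV[R]_n) : (u^T *m W *m v) 0 0 = 2 * dotmx (B^T *m u) (B^T *m v).
Proof. by rewrite /W /dotmx trmx_mul trmxK -scalemxAr -scalemxAl mxE !mulmxA. Qed.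

(** If W v = 0 then B^T v has zero length, and the right inverse of [B] makes B^T injective. *)
Lemma gram_unit : W \in unitmx.
Proof.
apply: unitmx_of_inj => v Wv0.
have : (v^T *m W *m v) 0 0 = 0 by rewrite -mulmxA Wv0 mulmx0 mxE.
rewrite formE => /eqP; rewrite mulf_eq0 pnatr_eq0/= => /eqP/dotmx_eq0 Bv0.
by rewrite -[v]mul1mx -trmx1 -BE trmx_mul -mulmxA Bv0 mulmx0.
Qed.

(* Cauchy-Schwarz for the form W, applied to v and W^-1 v. *)
Lemma gram_inv_ge (C : R) (v : 'cV[R]_n) : 0 < C ->
  (v^T *m W *m v) 0 0 <= C * dotmx v v ->
  dotmx v v <= C * (v^T *m invmx W *m v) 0 0.
Proof.
move=> C0 vC; have Wu := gram_unit.
have [->|v0] := eqVneq v 0; first by rewrite /dotmx !mulmx0 mxE mulr0.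
have d0 : 0 < dotmx v v.
  by rewrite lt_def dotmx_ge0 andbT; apply: contra v0 => /eqP/dotmx_eq0 ->.
pose u := invmx W *m v.
have vWu : dotmx v v = (v^T *m W *m u) 0 0 by rewrite /u -mulmxA mulKVmx.
have uWu : (v^T *m invmx W *m v) 0 0 = (u^T *m W *m u) 0 0.
  rewrite {2}/u -[u^T *m W *m _]mulmxA mulKVmx// -/(dotmx u v) dotmxC /dotmx /u.
  by rewrite mulmxA.
have cs : dotmx v v ^+ 2 <= (v^T *m W *m v) 0 0 * (u^T *m W *m u) 0 0.
  rewrite {1}vWu !formE.
  by have := dotmx_cauchy (B^T *m v) (B^T *m u); lra.
have q0 : 0 <= (u^T *m W *m u) 0 0 by rewrite formE mulr_ge0// dotmx_ge0.
rewrite uWu -(ler_pM2l d0) -expr2 (le_trans cs)// mulrA.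
by apply: ler_wpM2r => //; rewrite mulrC.
Qed.

End gram.
End dot.

Section weight.
Context {R : realType}.

Lemma unvech_inj p : injective (@unvech R p).
Proof. exact: can_inj (@unvechK R p). Qed.

(** D v is the vec of the symmetric matrix [unvech v], so D is injective; hence D^T D is invertible
    and D^+ is a left inverse. *)
Lemma duplication_pinvK p : duplication_pinv R p *m duplication R p = 1%:M.
Proof.
rewrite /duplication_pinv -mulmxA mulVmx//; apply: unitmx_of_inj => v Dv0.
have : dotmx (duplication R p *m v) (duplication R p *m v) = 0.
  by rewrite /dotmx trmx_mul -mulmxA [X in _ *m X]mulmxA Dv0 mulmx0 mxE.
move=> /dotmx_eq0; rewrite -{1}[v]unvechK duplicationP ?unvech_sym// => v0.
apply: unvech_inj; apply: (can_inj (@vecK R p p)); rewrite v0.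
have -> : unvech (0 : 'cV[R]_(vdim p)) = 0.
  apply/matrixP => i j; rewrite !mxE.
  set s := [seq _ | _ <- _]; set k := index _ _.
  have [ks|ks] := ltnP k (size s); last exact: nth_default.
  have /mapP[l _ ->] : nth 0 s k \in s by exact: mem_nth.
  by rewrite mxE.
by apply/matrixP => i j; rewrite !mxE.
Qed.

Lemma tens_mx1 m n : (1%:M : 'M[R]_m) *t (1%:M : 'M[R]_n) = 1%:M.
Proof.
apply/matrixP => i j; case: (mxtens_indexP i) => i0 i1; case: (mxtens_indexP j) => j0 j1.
by rewrite tensmxE !mxE -natrM mulnb (can_eq (@mxtens_indexK m n)).
Qed.

(* Sigma = N N^T with N = [Lambda S | diag(sigma)], so Sigma (x) Sigma is a Gram
   matrix of N (x) N, which inherits a right inverse from N. *)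
Lemma Wmat_gram p m r (A : 'M[R]_(p - m, m)) (S : 'M[R]_(m, r)) (sigma : 'cV[R]_p) :
  (forall i, sigma i 0 != 0) ->
  let theta := param A (S *m S^T) (\col_i sigma i 0 ^+ 2) in
  exists n (B : 'M[R]_(vdim p, n)) (E : 'M[R]_(n, vdim p)),
    B *m E = 1%:M /\ Wmat theta = 2 *: (B *m B^T).
Proof.
move=> s0 theta.
have SS : (S *m S^T)^T = S *m S^T by rewrite trmx_mul trmxK.
have [EA ES Es] := paramK A (\col_i sigma i 0 ^+ 2) SS.
pose L := Lambda A *m S; pose dg := diag_mx sigma^T.
pose N := row_mx L dg.
have SigmaE : Sigma theta = N *m N^T.
  rewrite /Sigma /theta EA ES Es /N tr_row_mx mul_row_col /L trmx_mul !mulmxA.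
  congr (_ + _); rewrite /dg tr_diag_mx mulmx_diag; congr diag_mx.
  by apply/rowP => i; rewrite !mxE expr2.
(* A right inverse of [N] supported on the diagonal block: it relies on sigma_i <> 0 only, whatever
   the rank of [L]. *)
pose M : 'M[R]_(r + p, p) := col_mx 0 (diag_mx (\row_i (sigma i 0)^-1)).
have NM : N *m M = 1%:M.
  rewrite /N /M mul_row_col mulmx0 add0r /dg mulmx_diag -diag_const_mx; congr diag_mx.
  by apply/rowP => i; rewrite !mxE divff.
exists ((r + p) * (r + p))%N, (duplication_pinv R p *m (N *t N)), ((M *t M) *m duplication R p).
split.
  rewrite mulmxA -(mulmxA (duplication_pinv R p)) tensmx_mul NM.
  by rewrite tens_mx1 mulmx1 duplication_pinvK.
rewrite /Wmat -/theta SigmaE; congr (_ *: _).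
by rewrite -tensmx_mul [in RHS]trmx_mul trmx_tens !mulmxA.
Qed.


(** Entrywise, so that each matrix operation reduces to finite sums and products of real
    functions. *)
Definition mx_continuous {V : topologicalType} m n (F : V -> 'M[R]_(m, n)) :=
  forall i j, continuous (fun x => F x i j).

Section mx_continuous.
Context {V : topologicalType}.

Lemma continuous_sum (I : Type) (s : seq I) (F : I -> V -> R) :
  (forall i, continuous (F i)) -> continuous (fun x => \sum_(i <- s) F i x).
Proof.
by move=> cF; apply: (@continuous_big _ _ +%R 0 xpredT) => // x; exact: add_continuous.
Qed.

Lemma continuous_cstM (c : R) (f : V -> R) :
  continuous f -> continuous (fun x => c * f x).
Proof. by move=> cf x; apply: cvgM; [exact: cvg_cst|exact: cf]. Qed.

Lemma continuous_cstB (c : R) (f : V -> R) :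
  continuous f -> continuous (fun x => c - f x).
Proof. by move=> cf x; apply: cvgB; [exact: cvg_cst|exact: cf]. Qed.

Lemma mx_continuous_cst m n (A : 'M[R]_(m, n)) : mx_continuous (fun _ : V => A).
Proof. by move=> i j; exact: cst_continuous. Qed.

Lemma mx_continuousD m n (F G : V -> 'M[R]_(m, n)) :
  mx_continuous F -> mx_continuous G -> mx_continuous (fun x => F x + G x).
Proof.
move=> cF cG i j x; under eq_fun do rewrite mxE.
by apply: cvgD; [exact: cF|exact: cG].
Qed.

Lemma mx_continuousM m n q (F : V -> 'M[R]_(m, n)) (G : V -> 'M[R]_(n, q)) :
  mx_continuous F -> mx_continuous G -> mx_continuous (fun x => F x *m G x).
Proof.
move=> cF cG i j; under eq_fun do rewrite mxE.
by apply: continuous_sum => k x; apply: cvgM; [exact: cF|exact: cG].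
Qed.

Lemma mx_continuous_tens m n q l (F : V -> 'M[R]_(m, n)) (G : V -> 'M[R]_(q, l)) :
  mx_continuous F -> mx_continuous G -> mx_continuous (fun x => F x *t G x).
Proof.
move=> cF cG i j x; under eq_fun do rewrite mxE.
by apply: cvgM; [exact: cF|exact: cG].
Qed.

Lemma mx_continuous_tr m n (F : V -> 'M[R]_(m, n)) :
  mx_continuous F -> mx_continuous (fun x => (F x)^T).
Proof. by move=> cF i j x; under eq_fun do rewrite mxE; exact: cF. Qed.

End mx_continuous.

Lemma mx_continuous_Sigma p m : mx_continuous (@Sigma R p m).
Proof.
have cA : mx_continuous (@A_of R p m).
  move=> i j; under eq_fun do rewrite !mxE; exact: coord_continuous.
have cS : mx_continuous (@Sff_of R p m).
  move=> i j; under eq_fun do rewrite mxE; move: (index _ _) => k.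
  pose F (theta : 'cV[R]_(qdim p m)) :=
    nth 0 [seq usubmx (dsubmx theta) l 0 | l <- enum 'I_(vdim m)] k.
  suff : continuous F by [].
  (* An index in range selects one coordinate of theta; out of range, [nth] returns its constant
     default. *)
  have [km|mk] := ltnP k (vdim m).
    have -> : F = fun theta => usubmx (dsubmx theta) (Ordinal km) 0.
      apply/funext => theta; rewrite /F (nth_map (Ordinal km)) ?size_enum_ord//.
      by congr (usubmx _ _ _); apply: val_inj; rewrite /= nth_enum_ord.
    under eq_fun do rewrite !mxE; exact: coord_continuous.
  have -> : F = fun=> 0.
    by apply/funext => theta; rewrite /F nth_default// size_map size_enum_ord.
  exact: cst_continuous.
have cD : mx_continuous (fun theta : 'cV[R]_(qdim p m) => diag_mx (s2_of theta)^T).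
  move=> i j; under eq_fun do rewrite !mxE.
  case: (i == j); last exact: cst_continuous.
  by under eq_fun do rewrite mulr1n; exact: coord_continuous.
have cL : mx_continuous (fun theta : 'cV[R]_(qdim p m) => Lambda (A_of theta)).
  (* For m > p the truncated subtraction breaks m + (p - m) = p, and [conform_mx] falls back to the
     constant 0. *)
  have [e|ne] := eqVneq (m + (p - m))%N p; last first.
    move=> i j; under eq_fun do rewrite /Lambda nonconform_mx ?ne//.
    exact: cst_continuous.
  have mp : (m <= p)%N by lia.
  move=> i j; under eq_fun do rewrite (LambdaE _ mp) castmxE mxE.
  case: (fintype.split _) => k; first exact: cst_continuous.
  exact: cA.
rewrite /Sigma; apply: mx_continuousD => //; apply: mx_continuousM.
  exact: mx_continuousM.
exact: mx_continuous_tr.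
Qed.

Lemma mx_continuous_Wmat p m : mx_continuous (@Wmat R p m).
Proof.
have -> : @Wmat R p m = fun theta => 2%:M *m (duplication_pinv R p *m
    (Sigma theta *t Sigma theta) *m (duplication_pinv R p)^T).
  by apply/funext => theta; rewrite mul_scalar_mx.
have cS := @mx_continuous_Sigma p m.
apply: mx_continuousM; first exact: mx_continuous_cst.
apply: mx_continuousM; last exact: mx_continuous_cst.
by apply: mx_continuousM; [exact: mx_continuous_cst|exact: mx_continuous_tens].
Qed.

Lemma vech_entry p (l : 'I_(vdim p)) :
  exists i j : 'I_p, forall A : 'M[R]_p, vech A l 0 = A i j.
Proof.
have ltl : (l < size (vech_pairs p))%N by rewrite size_vech_pairs.
have [i0 _] : {i0 : 'I_p & True}.
  by case E : (vech_pairs p) ltl => [//|[i j] s] _; exists i.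
exists (nth (i0, i0) (vech_pairs p) l).1, (nth (i0, i0) (vech_pairs p) l).2 => A.
by rewrite mxE (nth_map (i0, i0)).
Qed.

End weight.

Section separation.
Context {R : realType} (p m r : nat) (Theta : set 'cV[R]_(qdim p m)).
Hypothesis Theta_space : param_space r Theta.
Hypothesis s2_gt0 : forall theta, Theta theta -> forall i, 0 < s2_of theta i 0.

Lemma Wmat_gramT theta : Theta theta ->
  exists n (B : 'M[R]_(vdim p, n)) (E : 'M[R]_(n, vdim p)),
    B *m E = 1%:M /\ Wmat theta = 2 *: (B *m B^T).
Proof.
move=> Tt; have [_ _ /(_ _ Tt)[A [S [sigma tE]]]] := Theta_space.
rewrite tE; apply: Wmat_gram => i; have := s2_gt0 Tt i.
have SS : (S *m S^T)^T = S *m S^T by rewrite trmx_mul trmxK.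
have [_ _ Es] := paramK A (\col_i sigma i 0 ^+ 2) SS.
rewrite tE Es mxE; apply: contraTneq => ->; by rewrite expr0n ltxx.
Qed.

Lemma Sigma_sym theta : (Sigma theta : 'M[R]_p)^T = Sigma (m := m) theta.
Proof.
rewrite /Sigma raddfD/= tr_diag_mx !trmx_mul trmxK /Sff_of unvech_sym.
by rewrite mulmxA.
Qed.

(** Continuous entries are bounded on the compact [Theta], and |v_i v_j| is at most |v|^2. The
    summand 1 in the witness ensures C > 0. *)
Lemma Wmat_form_bound : exists C : R, 0 < C /\
  forall theta, Theta theta -> forall v : 'cV[R]_(vdim p),
    (v^T *m Wmat theta *m v) 0 0 <= C * dotmx v v.
Proof.
have [_ cT _] := Theta_space.
have bnd i j : exists c : R, forall theta, Theta theta -> `|Wmat theta i j| <= c.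
  have [T0|/set0P T0] := eqVneq Theta set0.
    by exists 0 => theta; rewrite T0.
  have cf : continuous (fun theta : 'cV[R]_(qdim p m) => `|Wmat theta i j|).
    move=> x; apply: (cvg_comp (fun theta : 'cV[R]_(qdim p m) => Wmat theta i j) (fun y => `|y|)).
      exact: mx_continuous_Wmat.
    exact: norm_continuous.
  have [c _ cP] := compact_EVT_max T0 cT (continuous_subspaceT cf).
  by exists `|Wmat c i j| => theta Tt; apply: cP; exact: mem_set.
pose c i j := sval (cid (bnd i j)); have cP i j := svalP (cid (bnd i j)).
exists (1 + \sum_i \sum_j `|c i j|); split.
  by rewrite ltr_wpDr// sumr_ge0// => i _; rewrite sumr_ge0.
move=> theta Tt v.
rewrite mulrDl mul1r (le_trans _ (_ : (\sum_i \sum_j `|c i j|) * dotmx v v <= _))//; last first.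
  by rewrite lerDr dotmx_ge0.
rewrite -mulmxA mxE mulr_suml; apply: ler_sum => i _.
rewrite !mxE mulr_sumr mulr_suml; apply: ler_sum => j _.
have c0 : `|Wmat theta i j| <= `|c i j| by rewrite (le_trans (cP _ _ _ Tt))// ler_norm.
have vij : `|v i 0 * v j 0| <= dotmx v v.
  have := sqr_coord_le_dotmx v i; have := sqr_coord_le_dotmx v j.
  by rewrite ler_norml => vi vj; apply/andP; split; nra.
rewrite mulrCA (le_trans (ler_norm _))// normrM ler_pM//.
Qed.

(** The discrepancy is at least 1/C times the squared distance of the half-vectorizations, which
    reduces the claim to a Euclidean distance that is continuous in theta and attains its
    minimum. *)
Lemma discrepancy_separated (Sigma0 : 'M[R]_p) thetabar :
  Sigma0^T = Sigma0 -> is_argmin Theta (discrepancy Sigma0) thetabar ->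
  Sigma0 <> Sigma thetabar ->
  exists eta kappa : R, [/\ 0 < eta, 0 < kappa &
    forall (M : 'M[R]_p) theta, (forall i j, `|M i j - Sigma0 i j| <= eta) ->
      Theta theta -> kappa <= discrepancy M theta].
Proof.
move=> sym0 [Tbar minbar] mis; have [_ cT _] := Theta_space.
have [C [C0 CP]] := Wmat_form_bound.
have lower M theta : Theta theta ->
    dotmx (vech M - vech (Sigma theta)) (vech M - vech (Sigma theta))
    <= C * discrepancy M theta.
  move=> Tt; have [n [B [E [BE WE]]]] := Wmat_gramT Tt.
  rewrite /discrepancy; set v := vech M - _.
  have vC := CP _ Tt v; rewrite WE in vC *.
  exact (gram_inv_ge BE C0 vC).
(* A theta reproducing [Sigma0] would make the minimum of U zero; the lower bound at [thetabar]
   would then force equality there too, against misspecification. *)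
have vech_neq theta : Theta theta -> vech Sigma0 - vech (Sigma theta) != 0.
  move=> Tt; apply/eqP => v0.
  have /eqP : discrepancy Sigma0 theta = 0 by rewrite /discrepancy v0 mulmx0 mxE.
  have := minbar _ Tt => /[swap] /eqP -> le0.
  have dot0 : dotmx (vech Sigma0 - vech (Sigma thetabar)) (vech Sigma0 - vech (Sigma thetabar)) = 0.
    apply/eqP; rewrite eq_le dotmx_ge0 andbT (le_trans (lower _ _ Tbar))//.
    by rewrite pmulr_rle0.
  apply: mis; rewrite -(vechK sym0) -(vechK (Sigma_sym thetabar)).
  by congr unvech; apply/eqP; rewrite -subr_eq0; apply/eqP/dotmx_eq0.
pose g (theta : 'cV[R]_(qdim p m)) :=
  dotmx (vech Sigma0 - vech (Sigma theta)) (vech Sigma0 - vech (Sigma theta)).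
have cg : continuous g.
  have -> : g = fun theta => \sum_l (vech Sigma0 l 0 - vech (Sigma theta) l 0) ^+ 2.
    apply/funext => theta; rewrite /g dotmx_sqr; apply: eq_bigr => l _.
    by rewrite colB.
  apply: continuous_sum => l.
  have [i [j ijE]] := @vech_entry R p l; under eq_fun do rewrite !ijE.
  by apply: continuous_sqr; apply: continuous_cstB; exact: mx_continuous_Sigma.
have [th0 th0T gmin] := compact_EVT_min (ex_intro _ _ Tbar) cT (continuous_subspaceT cg).
pose delta := g th0.
have delta0 : 0 < delta.
  rewrite lt_def dotmx_ge0 andbT; apply: contra (vech_neq _ (set_mem th0T)).
  by move=> /eqP/dotmx_eq0 ->.
(* [V] exceeds the number of coordinates and is positive even for p = 0; eta is chosen so that V
   eta^2 = delta / 4. *)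
pose V : R := (vdim p)%:R + 1.
have V0 : 0 < V by rewrite ltr_wpDl.
pose eta := Num.sqrt (delta / (4 * V)).
have eta2 : eta ^+ 2 = delta / (4 * V).
  by rewrite sqr_sqrtr// divr_ge0 ?mulr_ge0 ?(ltW delta0) ?(ltW V0).
exists eta, (delta / (4 * C)); split.
- by rewrite sqrtr_gt0 divr_gt0// mulr_gt0.
- by rewrite divr_gt0// mulr_gt0.
move=> M theta close Tt.
suff : delta / 4 <= C * discrepancy M theta.
  by move=> le_C; rewrite invfM mulrA ler_pdivrMr// [leRHS]mulrC.
apply: le_trans (lower M _ Tt).
have gt : delta <= g theta by apply: gmin; exact: mem_set.
pose a := vech M; pose b := vech Sigma0; pose c := vech (Sigma theta).
have ab : dotmx (a - b) (a - b) <= delta / 4.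
  rewrite dotmx_sqr (@le_trans _ _ (\sum_(l < vdim p) eta ^+ 2))//.
    apply: ler_sum => l _; have [i [j ijE]] := @vech_entry R p l.
    rewrite colB !ijE -[leLHS](real_normK (num_real _)).
    by rewrite lerXn2r ?nnegrE ?sqrtr_ge0.
  rewrite sumr_const card_ord -[_ *+ vdim p]mulr_natl.
  have -> : delta / 4 = V * eta ^+ 2 by rewrite eta2; field; rewrite gt_eqF.
  by rewrite ler_wpM2r ?sqr_ge0// /V lerDl.
(* Since |b - c|^2 >= delta and |a - b|^2 <= delta / 4, this leaves |a - c|^2 >= delta / 4, the
   origin of kappa = delta / (4 C). *)
have : g theta <= 2 * dotmx (a - b) (a - b) + 2 * dotmx (a - c) (a - c).
  rewrite /g !dotmx_sqr !mulr_sumr -big_split/=; apply: ler_sum => l _.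
  rewrite -/b -/c !colB.
  by have := sqr_ge0 (2 * a l 0 - b l 0 - c l 0); nra.
by rewrite -/a -/c; lra.
Qed.

End separation.

(** * Measurability of the minimal discrepancy *)

Section mx_measurable.
Context {R : realType}.

Lemma continuous_of_mx_continuous (V : topologicalType) m n (F : V -> 'M[R]_(m, n)) :
  mx_continuous F -> continuous F.
Proof.
move=> cF x A /= /nbhs_ballP[e e0 eA].
have nF : \forall y \near x, forall i j, ball (F x i j) e (F y i j).
  by do 2 apply: filter_forall => ?; apply: cF; exact: nbhsx_ballx.
apply: filterS nF => y Fy; apply: eA; split => //.
Qed.

Context d (T : measurableType d).

(** An open set of matrices is a countable union of boxes with rational centres, and a box is a
    finite intersection of conditions on entries. *)
Lemma measurable_preimage_open m n (F : T -> 'M[R]_(m, n)) (O : set 'M[R]_(m, n)) :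
  (forall i j, measurable_fun setT (fun w => F w i j)) -> open O ->
  measurable (F @^-1` O).
Proof.
move=> mF oO.
pose box (qk : 'M[rat]_(m, n) * nat) : set 'M[R]_(m, n) :=
  [set M | forall i j, `|M i j - ratr (qk.1 i j)| < qk.2.+1%:R^-1].
have mbox qk : measurable (F @^-1` box qk).
  rewrite (_ : _ @^-1` _ = \bigcap_(i in [set: 'I_m]) \bigcap_(j in [set: 'I_n])
      [set w | `|F w i j - ratr (qk.1 i j)| < qk.2.+1%:R^-1]); last first.
    by apply/seteqP; split => w /= bw => [i _ j _|i j]; apply: bw.
  apply: fin_bigcap_measurable => // i _; apply: fin_bigcap_measurable => // j _.
  have mG : measurable_fun setT (fun w => `|F w i j - ratr (qk.1 i j)|).
    by apply: measurableT_comp => //; apply: measurable_funB.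
  rewrite -[X in measurable X]setTI.
  rewrite (_ : [set w | _] = (fun w => `|F w i j - ratr (qk.1 i j)|) @^-1` `]-oo, qk.2.+1%:R^-1[).
    exact: mG.
  by apply/seteqP; split => w /=; rewrite in_itv.
rewrite (_ : F @^-1` O = \bigcup_qk (if `[< box qk `<=` O >] then F @^-1` box qk else set0)).
  by apply: countable_bigcupT_measurable => // qk; case: ifP.
apply/seteqP; split => [w Ow|w [qk _]]; last by case: asboolP => // bO /bO.
have /nbhs_ballP[e e0 eO] : nbhs (F w) O by exact: open_nbhs_nbhs.
(* Half of e: a point of the box reaches [F w] through the rational centre, two steps of length
   below 1/(k+1). *)
have [k ke] : exists k, k.+1%:R^-1 < e / 2.
  have e2 : 0 < e / 2 by rewrite divr_gt0.
  have [N _ /(_ N (leqnn N))] := near_infty_natSinv_lt (PosNum e2).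
  by exists N.
have k0 : 0 < k.+1%:R^-1 :> R by [].
have ratP (x : R) : exists q : rat, `|x - ratr q| < k.+1%:R^-1.
  have /rat_in_itvoo[q] : x < x + k.+1%:R^-1 by rewrite ltrDl.
  rewrite in_itv/= => /andP[xq qx]; exists q.
  by rewrite distrC ger0_norm ?subr_ge0 ?(ltW xq)// ltrBlDl.
pose q := \matrix_(i < m, j < n) sval (cid (ratP (F w i j))).
have wq : box (q, k) (F w) by move=> i j; rewrite /q mxE; exact: svalP (cid (ratP _)).
exists (q, k) => //; case: asboolP => // -[] M Mq; apply: eO; split => // i j.
rewrite /ball/= (_ : F w i j - M i j =
  (F w i j - ratr (q i j)) - (M i j - ratr (q i j))); last ring.
rewrite (le_lt_trans (ler_normB _ _))//.
move: ke (wq i j) (Mq i j) => /=; move: (k.+1%:R^-1) => r re wr Mr.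
by rewrite (lt_trans (ltrD wr Mr))// (splitr e) ltrD.
Qed.

Lemma measurable_comp_continuous m n (F : T -> 'M[R]_(m, n)) (g : 'M[R]_(m, n) -> R) :
  (forall i j, measurable_fun setT (fun w => F w i j)) -> continuous g ->
  measurable_fun setT (g \o F).
Proof.
move=> mF cg; apply: (measurability _ (RGenOpens.measurableE R)).
move=> _ [_ [a [b ->]] <-]; rewrite setTI.
apply: (measurable_preimage_open (O := g @^-1` `]a, b[)) => //.
by apply: open_comp => // M _; exact: cg.
Qed.

End mx_measurable.

Section discrepancy_measurable.
Context {R : realType} (p m : nat).

Lemma continuous_discrepancy (theta : 'cV[R]_(qdim p m)) :
  continuous (fun M : 'M[R]_p => discrepancy M theta).
Proof.
have cv : mx_continuous (fun M : 'M[R]_p => vech M - vech (Sigma theta)).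
  apply: mx_continuousD; last exact: mx_continuous_cst.
  move=> l j; rewrite ord1; have [i [i' E]] := @vech_entry R p l.
  by under eq_fun do rewrite E; exact: coord_continuous.
have cq : mx_continuous (fun M : 'M[R]_p => (vech M - vech (Sigma theta))^T
    *m invmx (Wmat theta) *m (vech M - vech (Sigma theta))).
  apply: mx_continuousM => //; apply: mx_continuousM; last exact: mx_continuous_cst.
  exact: mx_continuous_tr.
exact: cq.
Qed.

(* The minimizer need not depend measurably on the sample, but the minimum does:
   it is an infimum of continuous functions of M, hence upper semicontinuous. *)
Lemma measurable_argmin_gt d (T : measurableType d) (Theta : set 'cV[R]_(qdim p m))
    (M : T -> 'M[R]_p) (theta : T -> 'cV[R]_(qdim p m)) (x c : R) :
  (forall i j, measurable_fun setT (fun w => M w i j)) ->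
  (forall w, is_argmin Theta (discrepancy (M w)) (theta w)) -> 0 <= x ->
  measurable [set w | c < x * discrepancy (M w) (theta w)].
Proof.
move=> mM argm x0.
(* The slack 1/(j+1) allows a strict inequality, hence an open set; as the minimum is attained, the
   intersection over j says exactly that it is at most c. *)
pose O (j : nat) := [set N : 'M[R]_p | exists2 t, Theta t & x * discrepancy N t < c + j.+1%:R^-1].
have -> : [set w | c < x * discrepancy (M w) (theta w)] = ~` \bigcap_j (M @^-1` O j).
  apply/seteqP; split => w /=.
    move=> cw Ow.
    have [j jP] : exists j : nat, j.+1%:R^-1 < x * discrepancy (M w) (theta w) - c.
      have d0 : 0 < x * discrepancy (M w) (theta w) - c by rewrite subr_gt0.
      have [N _ /(_ N (leqnn N))] := near_infty_natSinv_lt (PosNum d0).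
      by exists N.
    have [t Tt] := Ow j I; apply/negP; rewrite -leNgt.
    have [_ /(_ _ Tt) le_t] := argm w.
    move: (ler_wpM2l x0 le_t) jP; move: (j.+1%:R^-1) => y; lra.
  apply: contra_notT; rewrite -leNgt => le_c j _; exists (theta w).
    by have [] := argm w.
  by rewrite (le_lt_trans le_c)// ltrDl.
apply: measurableC; apply: bigcap_measurableType => j _.
apply: measurable_preimage_open => //.
rewrite (_ : O j = \bigcup_(t in Theta) [set N | x * discrepancy N t < c + j.+1%:R^-1]); last first.
  by apply/seteqP; split => N /= [t]; exists t.
apply: bigcup_open => t _.
have cx : continuous (fun N : 'M[R]_p => x * discrepancy N t).
  by apply: continuous_cstM; exact: continuous_discrepancy.
apply: (@open_comp _ _ (fun N : 'M[R]_p => x * discrepancy N t) [set y | y < c + j.+1%:R^-1]).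
  by move=> N _; exact: cx.
exact: open_lt.
Qed.

End discrepancy_measurable.

(** * Convergence of the realized covariation *)

Section moment_bounds.
Context {R : realType} d (T : measurableType d) (P : probability T R).

(** Measurability is bundled with the bound, so that one calculus delivers both; the measurability
    of [QXX] is later read off from its L1 estimate. *)
Definition L1_le (f : T -> R) (c : R) : Prop :=
  measurable_fun setT f /\ (\int[P]_w (`|f w|)%:E <= c%:E)%E.

Definition L2_le (f : T -> R) (c : R) : Prop :=
  measurable_fun setT f /\ (\int[P]_w (f w ^+ 2)%:E <= c%:E)%E.

Lemma L1_leW f c c' : c <= c' -> L1_le f c -> L1_le f c'.
Proof. by move=> cc' [mf fc]; split => //; rewrite (le_trans fc)// lee_fin. Qed.

Lemma L1_le0 : L1_le (fun=> 0) 0.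
Proof. by split => //; under eq_integral do rewrite normr0; rewrite integral0. Qed.

Let mnorm (f : T -> R) : measurable_fun setT f ->
  measurable_fun setT (fun w => (`|f w|)%:E).
Proof. by move=> mf; apply/measurable_EFinP; exact: measurableT_comp. Qed.

Lemma L1_leD f g a b : L1_le f a -> L1_le g b -> L1_le (fun w => f w + g w) (a + b).
Proof.
move=> [mf fa] [mg gb]; have mfg : measurable_fun setT (fun w => f w + g w).
  exact: measurable_funD.
split => //; apply: (@le_trans _ _ (\int[P]_w ((`|f w|)%:E + (`|g w|)%:E))%E).
  apply: ge0_le_integral => //.
  - exact: mnorm.
  - by apply: emeasurable_funD; exact: mnorm.
  - by move=> w _; rewrite -EFinD lee_fin ler_normD.
rewrite ge0_integralD//; [|exact: mnorm|exact: mnorm].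
by rewrite EFinD leeD.
Qed.

Lemma L1_le_norm f a : L1_le f a -> L1_le (fun w => `|f w|) a.
Proof.
move=> [mf fa]; split; first exact: measurableT_comp.
by under eq_integral do rewrite normr_id.
Qed.

Lemma L1_leZ k f a : L1_le f a -> L1_le (fun w => k * f w) (`|k| * a).
Proof.
move=> [mf fa]; split; first exact: measurable_funM.
under eq_integral do rewrite normrM EFinM.
rewrite ge0_integralZl//; last by exact: mnorm.
by rewrite EFinM lee_wpmul2l// lee_fin.
Qed.

Lemma L1_le_sum (I : Type) (s : seq I) (f : I -> T -> R) (a : I -> R) :
  (forall i, L1_le (f i) (a i)) ->
  L1_le (fun w => \sum_(i <- s) f i w) (\sum_(i <- s) a i).
Proof.
move=> fa; elim: s => [|i s IH].
  by rewrite big_nil; under eq_fun do rewrite big_nil; exact: L1_le0.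
by rewrite big_cons; under eq_fun do rewrite big_cons; exact: L1_leD.
Qed.

Lemma L1_le_sum_nat (n : nat) (f : nat -> T -> R) (a : R) :
  (forall i, (0 < i)%N -> L1_le (f i) a) ->
  L1_le (fun w => \sum_(1 <= i < n.+1) f i w) (n%:R * a).
Proof.
move=> fa; under eq_fun do rewrite big_add1.
have -> : n%:R * a = \sum_(0 <= i < n) a by rewrite sumr_const_nat subn0 mulr_natl.
by apply: L1_le_sum => i; exact: fa.
Qed.

(* AM-GM: |f g| <= (beta f^2 + g^2 / beta) / 2. *)
Lemma L1_leM (beta : R) f g a b : 0 < beta -> L2_le f a -> L2_le g b ->
  L1_le (fun w => f w * g w) ((beta * a + b / beta) / 2).
Proof.
move=> b0 [mf fa] [mg gb]; have mfg : measurable_fun setT (fun w => f w * g w).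
  exact: measurable_funM.
have msq (h : T -> R) : measurable_fun setT h -> measurable_fun setT (fun w => (h w ^+ 2)%:E).
  by move=> mh; apply/measurable_EFinP; exact: measurable_funX.
have c1 : 0 <= beta / 2 by rewrite divr_ge0// ltW.
have c2 : 0 <= (2 * beta)^-1 by rewrite invr_ge0 mulr_ge0// ltW.
split => //.
apply: (@le_trans _ _ (\int[P]_w ((beta / 2)%:E * (f w ^+ 2)%:E
    + (2 * beta)^-1%:E * (g w ^+ 2)%:E))%E).
  apply: ge0_le_integral => //.
  - exact: mnorm.
  - by apply: emeasurable_funD; apply: emeasurable_funM => //; exact: msq.
  - move=> w _; rewrite -!EFinM -EFinD lee_fin normrM.
    rewrite -(real_normK (num_real (f w))) -(real_normK (num_real (g w))).
    move: `|f w| `|g w| => x y.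
    have := sqr_ge0 (beta * x - y); rewrite -subr_ge0.
    have -> : beta / 2 * x ^+ 2 + (2 * beta)^-1 * y ^+ 2 - x * y =
      (2 * beta)^-1 * (beta * x - y) ^+ 2 by field; rewrite gt_eqF.
    by move=> /(mulr_ge0 c2).
have sq0 (h : T -> R) w : (0 <= (h w ^+ 2)%:E)%E by rewrite lee_fin sqr_ge0.
rewrite ge0_integralD//; first last.
- by apply: emeasurable_funM => //; exact: msq.
- by move=> w _; apply: mule_ge0 => //; rewrite lee_fin.
- by apply: emeasurable_funM => //; exact: msq.
- by move=> w _; apply: mule_ge0 => //; rewrite lee_fin.
rewrite !ge0_integralZl_EFin//; [|exact: msq..].
have -> : ((beta * a + b / beta) / 2)%:E = ((beta / 2)%:E * a%:E + (2 * beta)^-1%:E * b%:E)%E.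
  by rewrite -!EFinM -EFinD; congr EFin; field; rewrite gt_eqF.
by apply: leeD; apply: lee_wpmul2l => //; rewrite lee_fin.
Qed.

Lemma L2_le1 : L2_le (fun=> 1) 1.
Proof.
split => //; under eq_integral do rewrite expr1n.
by rewrite integral_cst// mul1e [leLHS]probability_setT.
Qed.

Lemma L2_le_Rintegral (f : T -> R) (c : R) : measurable_fun setT f ->
  P.-integrable setT (fun w => (f w ^+ 2)%:E) -> \int[P]_w (f w ^+ 2) <= c -> L2_le f c.
Proof.
move=> mf fi fc; split => //.
by rewrite -(fineK (integrable_fin_num measurableT fi)) lee_fin.
Qed.

Lemma L1_le_markov (f : T -> R) (c eta : R) : 0 < eta -> L1_le f c ->
  measurable [set w | (eta < `|f w|)%R] /\
  (P [set w | (eta < `|f w|)%R] <= (c / eta)%:E)%E.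
Proof.
move=> e0 [mf fc].
have mA : measurable [set w | (eta < `|f w|)%R].
  rewrite -[X in measurable X]setTI.
  have mn : measurable_fun setT (fun w => `|f w|) by exact: measurableT_comp.
  rewrite (_ : [set w | _] = (fun w => `|f w|) @^-1` `]eta, +oo[); first exact: mn.
  by apply/seteqP; split => w /=; rewrite in_itv/= andbT.
split => //; rewrite EFinM lee_pdivlMr// muleC; apply: le_trans fc.
rewrite -(integral_cst P mA eta%:E).
apply: (@le_trans _ _ (\int[P]_(w in [set w | (eta < `|f w|)%R]) (`|f w|)%:E)%E).
  apply: ge0_le_integral => //.
  - by move=> w _; rewrite lee_fin ltW.
  - by apply: measurable_funTS; exact: mnorm.
  - by move=> w /= /ltW; rewrite lee_fin.
by apply: ge0_subset_integral => //; exact: mnorm.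
Qed.

End moment_bounds.

(** The three summands belong to the centered Wiener products, of order n^(-1/2), the two mixed
    sums, of order sqrt h, and the product of drifts, of order h. *)
Definition covariation_const (R : realType) (J : finType) (p : nat)
    (L : 'I_p -> J -> R) (K : R) (a b : 'I_p) : R :=
  29 * (\sum_z \sum_z' `|L a z * L b z'|)
  + (\sum_z `|L a z| + \sum_z `|L b z|) * ((1 + K) / 2) + K.

Section realized_covariation.
Context {R : realType} d (T : measurableType d) (P : probability T R).
Context (J : finType) (Z : J -> R -> T -> R).
Hypothesis wZ : forall z, wiener1 P (Z z).
Hypothesis indep_Z : forall z z', z != z' -> forall A B,
  sigma_gen `[0, +oo[ (Z z) A -> sigma_gen `[0, +oo[ (Z z') B -> P (A `&` B) = (P A * P B)%E.
Context (p : nat) (X : R -> T -> 'cV[R]_p) (L : 'I_p -> J -> R).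
Context (hs : nat -> R) (n : nat) (K : R).
Hypotheses (h_gt0 : 0 < hs n) (n_gt0 : (0 < n)%N) (K_ge0 : 0 <= K).

Let h := hs n.
Let Xc (a : 'I_p) (t : R) (w : T) := X t w a 0.
Let N (a : 'I_p) (i : nat) (w : T) := \sum_z L a z * incr (Z z) h i w.
Let D (a : 'I_p) (i : nat) (w : T) := incr (Xc a) h i w - N a i w.
Let Y (z z' : J) (i : nat) (w : T) :=
  incr (Z z) h i w * incr (Z z') h i w - (z == z')%:R * h.

Hypothesis D_L2 : forall a i, (0 < i)%N -> L2_le P (D a i) (K * h ^+ 2).

Let Y_L1 z z' : L1_le P (fun w => \sum_(1 <= i < n.+1) Y z z' i w)
  (29 * (h * Num.sqrt n%:R)).
Proof.
have n0 : 0 < n%:R :> R by rewrite ltr0n.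
have : Num.sqrt n%:R ^+ 2 = n%:R :> R by rewrite sqr_sqrtr// ltW.
have : 0 < h * Num.sqrt n%:R by rewrite mulr_gt0// sqrtr_gt0.
move: (Num.sqrt n%:R) => s s0 sn.
have mY : measurable_fun setT (fun w => \sum_(1 <= i < n.+1) Y z z' i w).
  apply: measurable_sum => i; apply: measurable_funB => //.
  by apply: measurable_funM; apply: measurable_incr.
have same_Z : z == z' -> Z z = Z z' by move=> /eqP ->.
have [iY bY] := covariation_L2 (wZ z) (wZ z') h_gt0 same_Z (indep_Z (z' := z')) n.
(* Against the constant 1, AM-GM with weight 1/(h sqrt n) gives both halves the order h sqrt n, with
   factor (57 + 1) / 2 = 29. *)
have sinv : 0 < (h * s)^-1 by rewrite invr_gt0.
have := L1_leM sinv (L2_le_Rintegral mY iY bY) (L2_le1 P).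
rewrite -sn.
have -> : ((h * s)^-1 * (s ^+ 2 * (57 * h ^+ 2)) + 1 / (h * s)^-1) / 2 = 29 * (h * s).
  by field; apply/andP; split; apply: contraTneq s0 => ->; rewrite ?mulr0 ?mul0r ltxx.
by under eq_fun do rewrite mulr1.
Qed.

Let ND_L1 z a i : (0 < i)%N ->
  L1_le P (fun w => incr (Z z) h i w * D a i w) (h * Num.sqrt h * ((1 + K) / 2)).
Proof.
move=> i0; have [iZ _ vZ _] := incr_moments (wZ z) h_gt0 i0.
have s0 : 0 < Num.sqrt h by rewrite sqrtr_gt0.
have ZL2 : L2_le P (incr (Z z) h i) h.
  apply: L2_le_Rintegral; [exact: measurable_incr|exact: (iZ 2 isT)|by rewrite vZ].
have hE : h = Num.sqrt h ^+ 2 by rewrite sqr_sqrtr// ltW.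
(* The weight sqrt h balances the second moments h of the Wiener increment and K h^2 of the
   drift. *)
apply: L1_leW (L1_leM s0 ZL2 (D_L2 a i0)).
have key (x s : R) : 0 < s -> x = s ^+ 2 -> (s * x + K * x ^+ 2 / s) / 2 <= x * s * ((1 + K) / 2).
  by move=> sgt0 ->; rewrite le_eqVlt; apply/orP; left; apply/eqP; field; rewrite gt_eqF.
exact: key.
Qed.

Let DD_L1 a b i : (0 < i)%N -> L1_le P (fun w => D a i w * D b i w) (K * h ^+ 2).
Proof.
move=> i0; apply: L1_leW (L1_leM ltr01 (D_L2 a i0) (D_L2 b i0)).
by rewrite divr1 mul1r; lra.
Qed.

(** Each increment of [X] is [N + D], Wiener part plus drift; expanding the product gives centered
    Wiener products, two mixed sums and a drift sum. *)
Let QXXE a b w : QXX X hs n w a b - \sum_z L a z * L b z =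
  (\sum_z \sum_z' (L a z * L b z' / (n%:R * h)) * (\sum_(1 <= i < n.+1) Y z z' i w)
  + \sum_(1 <= i < n.+1) \sum_z (L a z / (n%:R * h)) * (incr (Z z) h i w * D b i w))
  + (\sum_(1 <= i < n.+1) \sum_z (L b z / (n%:R * h)) * (incr (Z z) h i w * D a i w)
  + \sum_(1 <= i < n.+1) (n%:R * h)^-1 * (D a i w * D b i w)).
Proof.
have nh0 : n%:R * h != 0 by rewrite gt_eqF// mulr_gt0// ltr0n.
rewrite /QXX -/h mxE summxE.
have := mulVf nh0; move: (n%:R * h)^-1 => c hc.
have QE : \sum_(1 <= i < n.+1) (((X (i%:R * h) w - X (i.-1%:R * h) w)
      *m (X (i%:R * h) w - X (i.-1%:R * h) w)^T) a b) =
    \sum_(1 <= i < n.+1) incr (Xc a) h i w * incr (Xc b) h i w.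
  by apply: eq_bigr => i _; rewrite mxE big_ord1 !mxE.
rewrite QE.
have E1 : \sum_z \sum_z' (L a z * L b z' * c) * (\sum_(1 <= i < n.+1) Y z z' i w) =
    c * \sum_(1 <= i < n.+1) N a i w * N b i w - \sum_z L a z * L b z.
  rewrite [X in _ = X - _](_ : _ = \sum_z \sum_z' (L a z * L b z' * c) *
      \sum_(1 <= i < n.+1) (incr (Z z) h i w * incr (Z z') h i w)); last first.
    under [RHS]eq_bigr do (under eq_bigr do rewrite mulr_sumr).
    under [RHS]eq_bigr do rewrite exchange_big/=.
    rewrite [RHS]exchange_big/= mulr_sumr; apply: eq_bigr => i _.
    rewrite /N big_distrlr/= mulr_sumr; apply: eq_bigr => z _.
    by rewrite mulr_sumr; apply: eq_bigr => z' _; ring.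
  rewrite -sumrB; apply: eq_bigr => z _.
  (* A Kronecker delta spreads the limit over the double sum, where it cancels the centering of [Y]
     term by term. *)
  have -> : L a z * L b z = \sum_z' L a z * L b z' * (z == z')%:R.
    rewrite (bigD1 z)//= eqxx mulr1 big1 ?addr0// => z' z'z.
    by rewrite eq_sym (negbTE z'z) mulr0.
  rewrite -sumrB; apply: eq_bigr => z' _.
  rewrite /Y sumrB [X in _ * (_ - X)](_ : _ = (n%:R * h) * (z == z')%:R); last first.
    by rewrite sumr_const_nat subn1/= -[LHS]mulr_natl; ring.
  have e x y : x * c * (n%:R * h * y) = x * y.
    by rewrite -[RHS]mulr1 -[X in _ = _ * X]hc; ring.
  by rewrite mulrBr e.
rewrite E1.
have E2 (a' b' : 'I_p) : \sum_(1 <= i < n.+1) \sum_z (L a' z * c) * (incr (Z z) h i w * D b' i w)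
    = c * \sum_(1 <= i < n.+1) N a' i w * D b' i w.
  rewrite mulr_sumr; apply: eq_bigr => i _; rewrite /N mulr_suml mulr_sumr.
  by apply: eq_bigr => z _; ring.
rewrite !E2 -[X in _ + (_ + X)]mulr_sumr.
rewrite (eq_bigr (fun i => N a i w * N b i w + N a i w * D b i w + N b i w * D a i w
    + D a i w * D b i w)); last by move=> i _; rewrite /D; ring.
rewrite !big_split/= !mulrDr.
ring.
Qed.

Lemma QXX_L1 a b :
  L1_le P (fun w => QXX X hs n w a b - \sum_z L a z * L b z)
    (covariation_const L K a b * ((Num.sqrt n%:R)^-1 + Num.sqrt h + h)).
Proof.
have n0 : 0 < n%:R :> R by rewrite ltr0n.
have s0 : 0 < Num.sqrt n%:R :> R by rewrite sqrtr_gt0.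
have sn : Num.sqrt n%:R ^+ 2 = n%:R :> R by rewrite sqr_sqrtr// ltW.
have h0 : 0 < h by [].
have nh0 : 0 < n%:R * h by rewrite mulr_gt0.
have c_ge0 : 0 <= (n%:R * h)^-1 by rewrite invr_ge0 ltW.
under eq_fun do rewrite QXXE.
pose SL a := \sum_z `|L a z|; pose SLL := \sum_z \sum_z' `|L a z * L b z'|.
have SL0 a' : 0 <= SL a' by exact: sumr_ge0.
have SLL0 : 0 <= SLL by apply: sumr_ge0 => z _; exact: sumr_ge0.
have B1 : L1_le P (fun w => \sum_z \sum_z' (L a z * L b z' / (n%:R * h))
    * (\sum_(1 <= i < n.+1) Y z z' i w)) (SLL * (29 / Num.sqrt n%:R)).
  apply: L1_leW; last first.
    by apply: L1_le_sum => z; apply: L1_le_sum => z'; apply: L1_leZ; exact: Y_L1.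
  rewrite mulr_suml; apply: ler_sum => z _; rewrite mulr_suml; apply: ler_sum => z' _.
  rewrite normrM (ger0_norm c_ge0) -mulrA ler_wpM2l// -{1}sn.
  move: (Num.sqrt n%:R) s0 => s s0; rewrite le_eqVlt; apply/orP; left; apply/eqP.
  by field; rewrite !gt_eqF.
have B2 (a' b' : 'I_p) : L1_le P (fun w => \sum_(1 <= i < n.+1) \sum_z
    (L a' z / (n%:R * h)) * (incr (Z z) h i w * D b' i w)) (SL a' * (Num.sqrt h * ((1 + K) / 2))).
  apply: L1_leW; last first.
    apply: L1_le_sum_nat => i i0; apply: L1_le_sum => z; apply: L1_leZ; exact: ND_L1.
  rewrite -mulr_suml mulrA; under eq_bigr do rewrite normrM (ger0_norm c_ge0).
  rewrite -mulr_suml -/(SL a') le_eqVlt; apply/orP; left; apply/eqP.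
  by field; rewrite !gt_eqF.
have B3 : L1_le P (fun w => \sum_(1 <= i < n.+1) (n%:R * h)^-1 * (D a i w * D b i w)) (K * h).
  apply: L1_leW; last first.
    by apply: L1_le_sum_nat => i i0; apply: L1_leZ; exact: DD_L1.
  rewrite (ger0_norm c_ge0) le_eqVlt; apply/orP; left; apply/eqP.
  by field; rewrite !gt_eqF.
apply: L1_leW (L1_leD (L1_leD B1 (B2 a b)) (L1_leD (B2 b a) B3)).
rewrite /covariation_const -/(SL a) -/(SL b) -/SLL.
have si0 : 0 <= (Num.sqrt n%:R)^-1 :> R by rewrite invr_ge0 ltW.
have sh0 : 0 <= Num.sqrt h by exact: sqrtr_ge0.
have S1 : 0 <= (SL a + SL b) * ((1 + K) / 2).
  by rewrite mulr_ge0 ?addr_ge0// divr_ge0 ?addr_ge0.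
(* A sum of constants paired with their own rates is at most the sum of constants times the sum of
   rates, all terms being nonnegative. *)
have key (A B B' k x y v : R) : 0 <= A -> 0 <= (B + B') * k -> 0 <= x -> 0 <= y -> 0 <= v ->
    A * (29 * x) + B * (y * k) + (B' * (y * k) + K * v) <=
    (29 * A + (B + B') * k + K) * (x + y + v).
  move=> A0 S0 x0 y0 v0; rewrite -subr_ge0.
  have -> : (29 * A + (B + B') * k + K) * (x + y + v) -
      (A * (29 * x) + B * (y * k) + (B' * (y * k) + K * v)) =
    29 * A * (y + v) + (B + B') * k * (x + v) + K * (x + y) by ring.
  have A29 : 0 <= 29 * A by rewrite mulr_ge0.
  by apply: addr_ge0; [apply: addr_ge0|]; apply: mulr_ge0 => //; exact: addr_ge0.
by apply: key => //; exact: ltW.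
Qed.

End realized_covariation.

(** * The factor model *)

Section noise.
Context {R : realType} d (T : measurableType d) (P : probability T R).

Lemma mutual_indep_pair (J : finType) (F : J -> set (set T)) (i j : J) A B :
  mutual_indep P F -> i != j -> F i A -> F j B -> P (A `&` B) = (P A * P B)%E.
Proof.
move=> indF ij FA FB.
have := indF [set i; j]%SET (fun k => if k == i then A else B).
have -> : \bigcap_(k in [set` [set i; j]%SET]) (if k == i then A else B) = A `&` B.
  apply/seteqP; split => [w Kw|w [Aw Bw] k /=]; last by case: eqP.
  split; first by have := Kw i; rewrite /= !inE eqxx => /(_ isT).
  by have := Kw j; rewrite /= !inE eqxx orbT eq_sym (negbTE ij) => /(_ isT).
have -> : (\prod_(k in [set i; j]%SET) P (if k == i then A else B) = P A * P B)%E.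
  by rewrite big_setU1 ?inE//= big_set1 eqxx eq_sym (negbTE ij).
apply => k; rewrite !inE => /orP[] /eqP ->; first by rewrite eqxx.
by rewrite eq_sym (negbTE ij).
Qed.

Lemma sigma_gen_sub (I I' : Type) (D : set I) (D' : set I') (X : I -> T -> R)
    (X' : I' -> T -> R) : (forall i, D i -> exists2 i', D' i' & X i = X' i') ->
  sigma_gen D X `<=` sigma_gen D' X'.
Proof.
move=> DD'; apply: sub_sigma_algebra2 => _ [i Di [A mA <-]].
by have [i' Di' ->] := DD' _ Di; exists i' => //; exists A.
Qed.

Context (r p : nat) (W : R -> T -> 'cV[R]_r) (B : 'I_p -> R -> T -> R).
Hypothesis WB : driving_noise P W B.

(** One finite family for all scalar Wiener processes, so that the pairs W-W, W-B and B-B need no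
    separate treatment. *)
Definition noise_component (z : 'I_r + 'I_p) : R -> T -> R :=
  match z with inl j => fun t w => W t w j 0 | inr i => B i end.

Lemma wiener_noise z : wiener1 P (noise_component z).
Proof. by have [[wW _] wB _] := WB; case: z => [j|i] /=. Qed.

(** Two coordinates of W are independent by [wiener]. The other cases use the joint family, whose
    index [None] is all of W, with a sigma-algebra containing that of each coordinate. *)
Lemma indep_noise z z' : z != z' -> forall A A',
  sigma_gen `[0, +oo[ (noise_component z) A ->
  sigma_gen `[0, +oo[ (noise_component z') A' -> P (A `&` A') = (P A * P A')%E.
Proof.
have [[_ iW] _ iB] := WB.
have subW j : sigma_gen `[0, +oo[ (noise_component (inl j)) `<=`
    sigma_gen (`[0, +oo[ `*` [set: 'I_r]) (fun tj w => W tj.1 w tj.2 0).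
  by apply: sigma_gen_sub => t Dt; exists (t, j).
case: z z' => [j|i] [j'|i'] zz' A A' gA gA'.
- by apply: (mutual_indep_pair iW (i := j) (j := j')) => //; apply: contra zz' => /eqP ->.
- by apply: (mutual_indep_pair iB (i := None) (j := Some i')) => //; exact: subW gA.
- by apply: (mutual_indep_pair iB (i := Some i) (j := None)) => //; exact: subW gA'.
- exact: (mutual_indep_pair iB (i := Some i) (j := Some i')).
Qed.

End noise.

Section loadings.
Context {R : realType} (p k r : nat).

(** The entries of the block matrix [Lambda S | diag(sigma)], whose product with its own transpose
    is Sigma. *)
Definition noise_loading (A0 : 'M[R]_(p - k, k)) (S0 : 'M[R]_(k, r)) (sigma0 : 'cV[R]_p)
    (a : 'I_p) (z : 'I_r + 'I_p) : R :=
  match z with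
  | inl j => (Lambda A0 *m S0) a j
  | inr i => sigma0 i 0 * (i == a)%:R
  end.

Lemma sum_noise_loading A0 S0 sigma0 a b :
  \sum_z noise_loading A0 S0 sigma0 a z * noise_loading A0 S0 sigma0 b z =
  Sigma (param A0 (S0 *m S0^T) (\col_i sigma0 i 0 ^+ 2)) a b.
Proof.
have SS : (S0 *m S0^T)^T = S0 *m S0^T by rewrite trmx_mul trmxK.
have [EA ES Es] := paramK A0 (\col_i sigma0 i 0 ^+ 2) SS.
rewrite /Sigma EA ES Es big_sumType/= mxE; congr (_ + _).
  rewrite mulmxA -mulmxA -trmx_mul mxE; apply: eq_bigr => j _.
  by rewrite [X in _ = _ * X]mxE.
rewrite (bigD1 a)//= eqxx mulr1 big1 ?addr0.
  by rewrite !mxE; case: (eqVneq a b) => [->|ab]; rewrite ?mulr1 ?mulr0.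
by move=> i ia; rewrite (negbTE ia) mulr0 mul0r.
Qed.

End loadings.

Section drift_moments.
Context {R : realType} d (T : measurableType d) (P : probability T R).

Lemma L2_le_dominated (g q : T -> R) (a b M : R) : measurable_fun setT g ->
  measurable_fun setT q -> (forall w, 0 <= q w) -> 0 <= a -> 0 <= b ->
  (\int[P]_w (q w)%:E <= M%:E)%E -> (forall w, g w ^+ 2 <= a * q w + b) ->
  L2_le P g (a * M + b).
Proof.
move=> mg mq q0 a0 b0 qM gq; split => //.
have mqE : measurable_fun setT (fun w => (q w)%:E) by exact/measurable_EFinP.
apply: (@le_trans _ _ (\int[P]_w (a%:E * (q w)%:E + b%:E))%E).
  apply: ge0_le_integral => //.
  - by move=> w _; rewrite lee_fin sqr_ge0.
  - by apply/measurable_EFinP; exact: measurable_funX.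
  - by apply: emeasurable_funD => //; exact: emeasurable_funM.
  - by move=> w _; rewrite -EFinM -EFinD lee_fin.
rewrite ge0_integralD//; last 2 first.
- by move=> w _; rewrite -EFinM lee_fin mulr_ge0.
- exact: emeasurable_funM.
have -> : (\int[P]_w b%:E = b%:E)%E.
  by rewrite (integral_cst P measurableT b%:E) [X in (_ * X)%E]probability_setT mule1.
rewrite ge0_integralZl_EFin//; last by move=> w _; rewrite lee_fin.
by rewrite EFinD EFinM; apply: leeD => //; apply: lee_wpmul2l; rewrite ?lee_fin.
Qed.

Definition L2_bounded (F : R -> T -> R) : Prop :=
  exists2 K, 0 <= K & forall u, 0 <= u -> L2_le P (F u) K.

Lemma L2_boundedD F G : L2_bounded F -> L2_bounded G ->
  L2_bounded (fun u w => F u w + G u w).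
Proof.
move=> [K K0 FK] [K' K'0 GK]; exists (2 * (K + K')).
  by rewrite mulr_ge0// addr_ge0.
move=> u u0; have [mF FE] := FK _ u0; have [mG GE] := GK _ u0.
rewrite -[X in L2_le _ _ X]addr0.
apply: (@L2_le_dominated _ (fun w => F u w ^+ 2 + G u w ^+ 2)) => //.
- exact: measurable_funD.
- by apply: measurable_funD; exact: measurable_funX.
- by move=> w; rewrite addr_ge0 ?sqr_ge0.
- under eq_integral do rewrite EFinD.
  rewrite ge0_integralD//; first by rewrite EFinD leeD.
  + by move=> w _; rewrite lee_fin sqr_ge0.
  + by apply/measurable_EFinP; exact: measurable_funX.
  + by move=> w _; rewrite lee_fin sqr_ge0.
  + by apply/measurable_EFinP; exact: measurable_funX.
- move=> w; rewrite addr0.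
  by have := sqr_ge0 (F u w - G u w); nra.
Qed.

Lemma L2_boundedZ k F : L2_bounded F -> L2_bounded (fun u w => k * F u w).
Proof.
move=> [K K0 FK]; exists (k ^+ 2 * K); first by rewrite mulr_ge0 ?sqr_ge0.
move=> u u0; have [mF FE] := FK _ u0; rewrite -[X in L2_le _ _ X]addr0.
apply: (@L2_le_dominated _ (fun w => F u w ^+ 2)) => //.
- exact: measurable_funM.
- exact: measurable_funX.
- by move=> w; rewrite sqr_ge0.
- exact: sqr_ge0.
- by move=> w; rewrite addr0 exprMn.
Qed.

Lemma L2_bounded_sum (I : Type) (s : seq I) (F : I -> R -> T -> R) :
  (forall i, L2_bounded (F i)) -> L2_bounded (fun u w => \sum_(i <- s) F i u w).
Proof.
move=> bF; elim: s => [|i s [K K0 IH]].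
  exists 0 => // u _; rewrite /L2_le; under eq_fun do rewrite big_nil.
  split => //; under eq_integral do rewrite big_nil expr0n.
  by rewrite integral0.
have [K' K'0 D] := L2_boundedD (bF i) (ex_intro2 _ _ K K0 IH).
by exists K' => // u u0; under eq_fun do rewrite big_cons; exact: D.
Qed.

End drift_moments.

Section factor_model.
Context {R : realType} d (T : measurableType d) (P : probability T R).
Local Notation mu := (@lebesgue_measure R).

Lemma Rintegral_itv_linear (I : Type) (s : seq I) (c : I -> R) (g : I -> R -> R) (x y : R) :
  (forall i, continuous (g i)) ->
  \int[mu]_(u in `[x, y]) (\sum_(i <- s) c i * g i u) =
  \sum_(i <- s) c i * \int[mu]_(u in `[x, y]) g i u.
Proof.
move=> cg; elim: s => [|i s IH].
  rewrite big_nil; under eq_Rintegral do rewrite big_nil.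
  by rewrite Rintegral_cst// mul0r.
rewrite big_cons -IH; under eq_Rintegral do rewrite big_cons.
have cZ j : continuous (fun u => c j * g j u) by exact: continuous_cstM.
rewrite RintegralD//; first by rewrite RintegralZl//; exact: continuous_itv_integrable.
- exact: continuous_itv_integrable.
- by apply: continuous_itv_integrable; apply: continuous_sum.
Qed.

Lemma enorm_sqr n (x : 'cV[R]_n) : enorm x ^+ 2 = \sum_i x i 0 ^+ 2.
Proof. by rewrite /enorm sqr_sqrtr// sumr_ge0// => i _; exact: sqr_ge0. Qed.

Lemma coord_le_enorm n (x : 'cV[R]_n) i : `|x i 0| <= enorm x.
Proof.
rewrite -[leLHS]ger0_norm// -ler_sqr ?nnegrE ?sqrtr_ge0//.
by rewrite normr_id real_normK ?num_real// enorm_sqr -dotmx_sqr sqr_coord_le_dotmx.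
Qed.

Lemma enorm_second_moment n (X : R -> T -> 'cV[R]_n) : bounded_moments P X ->
  exists2 M, 0 <= M & forall t, 0 <= t -> (\int[P]_w (enorm (X t w) ^+ 2)%:E <= M%:E)%E.
Proof.
move=> /(_ 2 (ler0n _ _)); set s := ereal_sup _ => s_lty.
have ge_s t : 0 <= t -> (\int[P]_w (enorm (X t w) ^+ 2)%:E <= s)%E.
  move=> t0; apply: ereal_sup_ubound; exists t => //.
  by apply: eq_integral => w _; rewrite powR_mulrn// sqrtr_ge0.
have s0 : (0 <= s)%E.
  rewrite (le_trans _ (ge_s _ (lexx 0)))// integral_ge0// => w _.
  by rewrite lee_fin sqr_ge0.
exists (fine s); first exact: fine_ge0.
by move=> t t0; rewrite fineK ?ge_s// ge0_fin_numE.
Qed.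

Context (p r k : nat) (A0 : 'M[R]_(p - k, k)) (S0 : 'M[R]_(k, r)) (sigma0 : 'cV[R]_p).
Context (W : R -> T -> 'cV[R]_r) (B : 'I_p -> R -> T -> R).
Hypothesis hnoise : driving_noise P W B.
Context (b0 : 'cV[R]_k -> 'cV[R]_k) (B0 : 'I_p -> R -> R) (c1 : 'cV[R]_k) (c2 : 'cV[R]_p).
Context (f : R -> T -> 'cV[R]_k) (e : R -> T -> 'cV[R]_p).
Hypothesis hf : forall i, solves P (c1 i 0) (fun t w => b0 (f t w) i 0)
                      (fun t w => (S0 *m W t w) i 0) (fun t w => f t w i 0).
Hypothesis he : forall i, solves P (c2 i 0) (fun t w => B0 i (e t w i 0))
                      (fun t w => sigma0 i 0 * B i t w) (fun t w => e t w i 0).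
Hypothesis b0_cont : forall i, continuous (fun x => b0 x i 0).
Hypothesis B0_cont : forall i, continuous (B0 i).
Hypothesis b0_lip : exists C : R, 0 < C /\
  forall x y, enorm (b0 x - b0 y) <= C * enorm (x - y).
Hypothesis B0_lip : exists C : R, 0 < C /\
  forall i x y, `|B0 i x - B0 i y| <= C * `|x - y|.
Hypothesis f_mom : bounded_moments P f.
Hypothesis e_mom : bounded_moments P e.

Let fp (u : R) := f (Num.max u 0).
Let ep (u : R) := e (Num.max u 0).
Let max_ge0 (u : R) : 0 <= Num.max u 0. Proof. by rewrite le_max lexx orbT. Qed.

Let mfp u i : measurable_fun setT (fun w => fp u w i 0).
Proof. by have [mf _ _] := hf i; exact: mf. Qed.

Let mep u i : measurable_fun setT (fun w => ep u w i 0).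
Proof. by have [me _ _] := he i; exact: me. Qed.

Let cfp w : continuous (fp ^~ w).
Proof.
apply: continuous_of_mx_continuous => i j; rewrite ord1.
have [_ cf _] := hf i; exact: (continuous_max_of_within (cf w)).
Qed.

Let cep w i : continuous (fun u => ep u w i 0).
Proof. by have [_ ce _] := he i; exact: (continuous_max_of_within (ce w)). Qed.

(** The drift of coordinate a of X: factor drift carried by the loadings, plus the drift of the
    specific component, both at clamped time. *)
Let psi (a : 'I_p) (u : R) (w : T) : R :=
  \sum_j Lambda A0 a j * b0 (fp u w) j 0 + B0 a (ep u w a 0).

Let mb j u : measurable_fun setT (fun w => b0 (fp u w) j 0).
Proof.
apply: (measurable_comp_continuous (F := fp u) (g := fun x => b0 x j 0)) => //.
by move=> i l; rewrite ord1; exact: mfp.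
Qed.

Let mB a u : measurable_fun setT (fun w => B0 a (ep u w a 0)).
Proof. by apply: measurableT_comp => //; exact: continuous_measurable_fun. Qed.

Let cb j w : continuous (fun u => b0 (fp u w) j 0).
Proof.
move=> u; apply: (cvg_comp (fp ^~ w) (fun x => b0 x j 0)); first exact: cfp.
exact: b0_cont.
Qed.

Let cB a w : continuous (fun u => B0 a (ep u w a 0)).
Proof.
move=> u; apply: (cvg_comp (fun u => ep u w a 0) (B0 a)); first exact: cep.
exact: B0_cont.
Qed.

Let mpsi a u : measurable_fun setT (psi a u).
Proof.
by apply: measurable_funD => //; apply: measurable_sum => j; exact: measurable_funM.
Qed.

Let cpsi a w : continuous (psi a ^~ w).
Proof.
move=> u; apply: cvgD; last exact: cB.
by apply: continuous_sum => j; apply: continuous_cstM; exact: cb.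
Qed.

(** A Lipschitz drift grows at most linearly, so uniformly bounded second moments of f and e bound
    those of the drift. *)
Let L2_psi a : L2_bounded P (psi a).
Proof.
apply: L2_boundedD.
  apply: L2_bounded_sum => j; apply: L2_boundedZ.
  have [C [C0 CP]] := b0_lip; have [M M0 MP] := enorm_second_moment f_mom.
  exists (2 * C ^+ 2 * M + 2 * b0 0 j 0 ^+ 2).
    by apply: addr_ge0; apply: mulr_ge0 => //; [apply: mulr_ge0 => //|]; exact: sqr_ge0.
  move=> u u0; have fpE : fp u = f u by rewrite /fp max_l.
  apply: (@L2_le_dominated _ _ _ P _ (fun w => enorm (f u w) ^+ 2)) => //.
  - under eq_fun do rewrite enorm_sqr; apply: measurable_sum => i.
    by apply: measurable_funX; rewrite -fpE.
  - by move=> w; exact: sqr_ge0.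
  - by rewrite mulr_ge0 ?sqr_ge0.
  - by rewrite mulr_ge0 ?sqr_ge0.
  - exact: MP.
  - move=> w; rewrite fpE.
    have := le_trans (coord_le_enorm _ j) (CP (f u w) 0).
    rewrite subr0 colB; set x := b0 _ j 0; set y := b0 0 j 0; set v := enorm _ => xy.
    have v0 : 0 <= v by exact: sqrtr_ge0.
    have : (x - y) ^+ 2 <= C ^+ 2 * v ^+ 2.
      rewrite -exprMn -(real_normK (num_real (x - y))) lerXn2r ?nnegrE ?mulr_ge0//.
      exact: ltW.
    (* This square is the gap in x^2 <= 2 (x - y)^2 + 2 y^2, with y the drift at the origin. *)
    by have := sqr_ge0 (x - 2 * y); nra.
have [C [C0 CP]] := B0_lip; have [M M0 MP] := enorm_second_moment e_mom.
exists (2 * C ^+ 2 * M + 2 * B0 a 0 ^+ 2).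
  by apply: addr_ge0; apply: mulr_ge0 => //; [apply: mulr_ge0 => //|]; exact: sqr_ge0.
move=> u u0; have epE : ep u = e u by rewrite /ep max_l.
apply: (@L2_le_dominated _ _ _ P _ (fun w => enorm (e u w) ^+ 2)) => //.
- under eq_fun do rewrite enorm_sqr; apply: measurable_sum => i.
  by apply: measurable_funX; rewrite -epE.
- by move=> w; exact: sqr_ge0.
- by rewrite mulr_ge0 ?sqr_ge0.
- by rewrite mulr_ge0 ?sqr_ge0.
- exact: MP.
- move=> w; rewrite epE.
  have := CP a (e u w a 0) 0; have := coord_le_enorm (e u w) a.
  rewrite subr0; set x := B0 a _; set y := B0 a 0; set v := enorm _ => ev xy.
  have v0 : 0 <= v by exact: sqrtr_ge0.
  have xyv : `|x - y| <= C * v by rewrite (le_trans xy)// ler_pM2l.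
  have : (x - y) ^+ 2 <= C ^+ 2 * v ^+ 2.
    rewrite -exprMn -(real_normK (num_real (x - y))) lerXn2r ?nnegrE ?mulr_ge0//.
    exact: ltW.
  by have := sqr_ge0 (x - 2 * y); nra.
Qed.

Let Z := noise_component W B.
Let L := noise_loading A0 S0 sigma0.
Let X := observed A0 f e.

(** The null set does not depend on t, so differences between any two grid times can be taken on a
    single event. *)
Let X_decomposition (a : 'I_p) : {ae P, forall w, forall t, 0 <= t ->
  X t w a 0 = \sum_j Lambda A0 a j * c1 j 0 + c2 a 0
    + \int[mu]_(u in `[0, t]) psi a u w + \sum_z L a z * Z z t w}.
Proof.
have aef : {ae P, forall w, forall i t, 0 <= t ->
    f t w i 0 = c1 i 0 + \int[mu]_(s in `[0, t]) b0 (f s w) i 0 + (S0 *m W t w) i 0}.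
  by apply: filter_forall => i; have [_ _] := hf i.
have [_ _ aee] := he a.
apply: filterS2 aef aee => w fw ew t t0.
have intb j : \int[mu]_(s in `[0, t]) b0 (f s w) j 0 = \int[mu]_(s in `[0, t]) b0 (fp s w) j 0.
  by apply: eq_Rintegral => s; rewrite inE/= in_itv/= => /andP[s0 _]; rewrite /fp max_l.
have intB : \int[mu]_(s in `[0, t]) B0 a (e s w a 0) = \int[mu]_(s in `[0, t]) B0 a (ep s w a 0).
  by apply: eq_Rintegral => s; rewrite inE/= in_itv/= => /andP[s0 _]; rewrite /ep max_l.
rewrite /psi RintegralD//; last 2 first.
- apply: continuous_itv_integrable; apply: continuous_sum => j.
  by apply: continuous_cstM; exact: cb.
- by apply: continuous_itv_integrable; exact: cB.
rewrite Rintegral_itv_linear; last by move=> j; exact: cb.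
rewrite /X /observed mxE mxE ew// intB.
rewrite (eq_bigr (fun j => Lambda A0 a j * c1 j 0 + Lambda A0 a j *
    \int[mu]_(u in `[0, t]) b0 (fp u w) j 0 + Lambda A0 a j * (S0 *m W t w) j 0)); last first.
  by move=> j _; rewrite fw// intb !mulrDr.
rewrite !big_split/= big_sumType/=.
have -> : \sum_j Lambda A0 a j * (S0 *m W t w) j 0 = \sum_j (Lambda A0 *m S0) a j * W t w j 0.
  transitivity ((Lambda A0 *m (S0 *m W t w)) a 0); first by rewrite mxE.
  by rewrite mulmxA mxE.
have -> : \sum_i sigma0 i 0 * (i == a)%:R * B i t w = sigma0 a 0 * B a t w.
  rewrite (bigD1 a)//= eqxx mulr1 big1 ?addr0// => i ia.
  by rewrite (negbTE ia) mulr0 mul0r.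
by ring.
Qed.

Lemma measurable_observed t i : 0 <= t -> measurable_fun setT (fun w => X t w i 0).
Proof.
move=> t0; rewrite /X /observed; under eq_fun do rewrite mxE mxE.
apply: measurable_funD; last by have [+ _ _] := he i; apply.
apply: measurable_sum => j; apply: measurable_funM => //.
by have [+ _ _] := hf j; apply.
Qed.

Lemma observed_drift_L2 : exists2 K, 0 <= K & forall h i a, 0 < h -> (0 < i)%N ->
  L2_le P (fun w => incr (fun t w => X t w a 0) h i w - \sum_z L a z * incr (Z z) h i w)
    (K * h ^+ 2).
Proof.
have KP a := L2_psi a.
pose Ka a := sval (cid2 (KP a)).
have Ka0 a : 0 <= Ka a by rewrite /Ka; case: cid2.
have KaP a u : 0 <= u -> L2_le P (psi a u) (Ka a) by rewrite /Ka; case: cid2 => ? ? h; exact: h.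
(* The sum dominates the constant of every coordinate, so the bound is uniform in the coordinate and
   in the step. *)
exists (\sum_a Ka a); first exact: sumr_ge0.
move=> h i a h0 i0.
have t0 : 0 <= i.-1%:R * h by rewrite mulr_ge0// ltW.
have t1 : i.-1%:R * h < i%:R * h by rewrite ltr_pM2r// ltr_nat; lia.
have th : i%:R * h - i.-1%:R * h = h.
  by case: i i0 {t0 t1} => // i _; rewrite -mulrBl -natr1 addrC addKr mul1r.
set D := fun w : T => _; have mD : measurable_fun setT D.
  apply: measurable_funB.
    by apply: measurable_funB; apply: measurable_observed => //; rewrite mulr_ge0// ltW.
  apply: measurable_sum => z; apply: measurable_funM => //.
  exact: (measurable_incr (wiener_noise hnoise z) h0).
split => //.
have DE : {ae P, forall w, D w =
    \int[mu]_(u in `[0, i%:R * h]) psi a u w - \int[mu]_(u in `[0, i.-1%:R * h]) psi a u w}.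
  apply: filterS (X_decomposition a) => w Xw.
  rewrite /D /incr !Xw//; last by rewrite mulr_ge0// ltW.
  under [X in _ - X = _]eq_bigr do rewrite mulrBr.
  by rewrite sumrB; ring.
have psiK u : 0 <= u -> (\int[P]_w (psi a u w ^+ 2)%:E <= (Ka a)%:E)%E.
  by move=> u0; have [] := KaP a u u0.
have := @drift_increment_L2 _ _ _ P (psi a) (Ka a) _ _ D (mpsi a) (fun w => @cpsi a w)
  psiK t0 t1 mD DE.
rewrite th => /le_trans; apply; rewrite lee_fin ler_wpM2r ?sqr_ge0// (bigD1 a)//= lerDl.
exact: sumr_ge0.
Qed.

End factor_model.

(** * Rates of convergence and divergence of the test statistic *)

Section rates.
Context {R : realType}.

Lemma cvg_covariation_rate (h : nat -> R) : h n @[n --> \oo] --> 0 ->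
  ((Num.sqrt n%:R)^-1 + Num.sqrt (h n) + h n) @[n --> \oo] --> 0.
Proof.
move=> h0; rewrite -[X in _ --> X](_ : 0 + Num.sqrt 0 + 0 = _); last first.
  by rewrite sqrtr0 !addr0.
apply: cvgD => //; apply: cvgD.
  have -> : (fun n => (Num.sqrt n%:R)^-1) = (fun n : nat => Num.sqrt (n%:R^-1 : R)).
    by apply/funext => n; rewrite sqrtrV.
  rewrite -[X in _ --> X]sqrtr0.
  apply: (cvg_comp (fun n : nat => (n%:R^-1 : R)) Num.sqrt); last exact: sqrt_continuous.
  by rewrite -(cvg_shiftS (fun n : nat => (n%:R^-1 : R))); exact: cvg_harmonic.
exact: (cvg_comp h Num.sqrt h0 (@sqrt_continuous R 0)).
Qed.

(** Measurability and the bound are asked only eventually: the estimator minimizes for n >= 1, and n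
    kappa passes the threshold for large n. *)
Lemma cvg_probability1 d (T : measurableType d) (P : probability T R)
    (A : nat -> set T) (u : nat -> R) :
  (\forall n \near \oo, measurable (A n) /\ (P (~` A n) <= (u n)%:E)%E) ->
  u n @[n --> \oo] --> 0 -> P (A n) @[n --> \oo] --> 1%E.
Proof.
move=> Au u0.
apply: (@squeeze_cvge _ _ _ _ (fun n => (1 - u n)%:E) _ (cst 1%E)).
- near=> n; have [mA PA] : measurable (A n) /\ (P (~` A n) <= (u n)%:E)%E by near: n.
  apply/andP; split; last exact: probability_le1.
  have := probability_setC P (measurableC mA); rewrite setCK => ->.
  by rewrite EFinB leeB.
- apply: cvg_EFin; first by near=> n.
  by rewrite -[X in _ --> X]subr0; apply: cvgB => //; exact: cvg_cst.
- exact: cvg_cst.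
Unshelve. all: by end_near.
Qed.

End rates.
Theorem theorem4 (R : realType) (disp : measure_display)
    (Omega : measurableType disp) (P : probability Omega R)
    (p r k kstar : nat)
    (hp : (2 <= p)%N) (hr : (1 <= r)%N)
    (hk : (1 <= k < p)%N) (hkstar : (1 <= kstar < p)%N)
    (* parameter spaces *)
    (Theta : set 'cV[R]_(qdim p k)) (Thetastar : set 'cV[R]_(qdim p kstar))
    (hTheta : param_space r Theta) (hThetastar : param_space r Thetastar)
    (* true parameter *)
    (A0 : 'M[R]_(p - k, k)) (S0 : 'M[R]_(k, r)) (sigma0 : 'cV[R]_p)
    (hsigma0 : forall i, 0 < sigma0 i 0)
    (theta0 : 'cV[R]_(qdim p k))
    (htheta0 : theta0 = param A0 (S0 *m S0^T) (\col_i sigma0 i 0 ^+ 2))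
    (htheta0_int : Theta° theta0)
    (* driving noises and factor model *)
    (W : R -> Omega -> 'cV[R]_r) (B : 'I_p -> R -> Omega -> R)
    (hnoise : driving_noise P W B)
    (b0 : 'cV[R]_k -> 'cV[R]_k) (B0 : 'I_p -> R -> R)
    (c1 : 'cV[R]_k) (c2 : 'cV[R]_p)
    (f : R -> Omega -> 'cV[R]_k) (e : R -> Omega -> 'cV[R]_p)
    (hf : forall i, solves P (c1 i 0) (fun t w => b0 (f t w) i 0)
                      (fun t w => (S0 *m W t w) i 0) (fun t w => f t w i 0))
    (he : forall i, solves P (c2 i 0) (fun t w => B0 i (e t w i 0))
                      (fun t w => sigma0 i 0 * B i t w) (fun t w => e t w i 0))
    (* sampling scheme *)
    (h : nat -> R) (hh_gt0 : forall n, 0 < h n)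
    (hh0 : h n @[n --> \oo] --> 0)
    (hnh : n%:R * h n @[n --> \oo] --> +oo)
    (* minimizers *)
    (thetahat : nat -> Omega -> 'cV[R]_(qdim p kstar))
    (hthetahat : forall n w, (0 < n)%N ->
       is_argmin Thetastar (discrepancy (QXX (observed A0 f e) h n w))
         (thetahat n w))
    (thetabar : 'cV[R]_(qdim p kstar))
    (hthetabar : is_argmin Thetastar (discrepancy (Sigma theta0)) thetabar)
    (* test *)
    (hdf : (0 < vdim p - qdim p kstar)%N)
    (alpha c : R) (halpha : 0 < alpha <= 1)
    (hc : chi2_upper_point (vdim p - qdim p kstar) alpha c)
    (H1 : k <> kstar)
    (* (i) *)
    (hb_lip : exists C : R, 0 < C /\
       forall x y, enorm (b0 x - b0 y) <= C * enorm (x - y))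
    (hf_mom : bounded_moments P f)
    (hb_C4 : C4_poly b0)
    (* (ii) *)
    (pi_f : probability (borel R k) R) (hf_erg : ergodic P f pi_f)
    (* (iii) *)
    (hB_lip : exists C : R, 0 < C /\
       forall i x y, `|B0 i x - B0 i y| <= C * `|x - y|)
    (he_mom : bounded_moments P e)
    (hB_C4 : forall i, C4_poly1 (B0 i))
    (* (iv) *)
    (hs2 : forall theta, Theta theta -> forall i, 0 < s2_of theta i 0)
    (hs2star : forall theta, Thetastar theta -> forall i, 0 < s2_of theta i 0)
    (* (v) *)
    (pi_e : probability (borel R p) R) (he_erg : ergodic P e pi_e)
    (* (vi) *)
    (hrank : \rank (jacobian_vech_Sigma theta0) = qdim p k)
    (* (vii) *)
    (hident : forall theta, Thetastar theta ->
       discrepancy (Sigma theta0) theta = discrepancy (Sigma theta0) thetabar ->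
       theta = thetabar)
    (* (viii) *)
    (hmis : Sigma theta0 <> Sigma thetabar) :
  P [set w | c < n%:R * discrepancy (QXX (observed A0 f e) h n w) (thetahat n w)]
    @[n --> \oo] --> 1%E.
Proof.
have b0_cont i : continuous (fun x => b0 x i 0) by have [] := hb_C4 i.
have B0_cont i : continuous (B0 i) by have [] := hB_C4 i.
have [K K0 KP] := observed_drift_L2 A0 hnoise hf he b0_cont B0_cont
  hb_lip hB_lip hf_mom he_mom.
have theta0_sym := Sigma_sym theta0.
have [eta [kappa [eta0 kappa0 sep]]] :=
  discrepancy_separated hThetastar hs2star theta0_sym hthetabar hmis.
pose L := noise_loading A0 S0 sigma0.
pose X := observed A0 f e.
pose rate n : R := (Num.sqrt n%:R)^-1 + Num.sqrt (h n) + h n.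
have QL1 n a b : (0 < n)%N -> L1_le P (fun w => QXX X h n w a b - Sigma theta0 a b)
    (covariation_const L K a b * rate n).
  move=> n0; rewrite htheta0 -sum_noise_loading.
  apply: (QXX_L1 (wiener_noise hnoise) (indep_noise hnoise) (hh_gt0 n) n0 K0).
  by move=> a' i i0; exact: KP.
(* The errors of all entries are added, so that a single Markov bound makes every entry close at
   once. *)
pose err n w := \sum_a \sum_b `|QXX X h n w a b - Sigma theta0 a b|.
pose C := \sum_a \sum_b covariation_const L K a b.
have errL1 n : (0 < n)%N -> L1_le P (err n) (C * rate n).
  move=> n0; rewrite /C mulr_suml; apply: L1_le_sum => a.
  rewrite mulr_suml; apply: L1_le_sum => b; apply: L1_le_norm; exact: QL1.
apply: (@cvg_probability1 _ _ _ _ _ (fun n => C * rate n / eta)); last first.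
  rewrite -[X in _ --> X](_ : C * 0 / eta = 0); last by rewrite mulr0 mul0r.
  apply: cvgM; last exact: cvg_cst.
  by apply: cvgM; [exact: cvg_cst|exact: cvg_covariation_rate].
have mQ n a b : (0 < n)%N -> measurable_fun setT (fun w => QXX X h n w a b).
  move=> n0; have [mQ _] := QL1 n a b n0.
  have -> : (fun w => QXX X h n w a b) =
      (fun w => (QXX X h n w a b - Sigma theta0 a b) + Sigma theta0 a b).
    by apply/funext => w; rewrite subrK.
  exact: measurable_funD.
near=> n; have n0 : (0 < n)%N by near: n; exact: nbhs_infty_gt.
have nk : c < n%:R * kappa.
  rewrite -ltr_pdivrMr//; near: n.
  exact: nbhs_infty_gtr.
split.
  apply: (measurable_argmin_gt (Theta := Thetastar) (M := QXX X h n)) => //.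
    by move=> a b; exact: mQ.
  by move=> w; exact: hthetahat.
have [merr] := L1_le_markov eta0 (errL1 n n0).
apply: le_trans.
apply: le_measure; rewrite ?inE.
- apply: measurableC.
  apply: (measurable_argmin_gt (Theta := Thetastar) (M := QXX X h n)) => //.
    by move=> a b; exact: mQ.
  by move=> w; exact: hthetahat.
- exact: merr.
(* By contraposition: a total error at most eta puts every entry within eta, and then n F >= n kappa
   > c. *)
move=> w /=; apply: contra_notP => /negP; rewrite -leNgt => err_le.
apply: lt_le_trans nk _; rewrite ler_wpM2l//; apply: sep; last by have [] := hthetahat n w n0.
move=> a b; apply: le_trans err_le; apply: le_trans (ler_norm _).
rewrite /err (bigD1 a)//= (bigD1 b)//= -addrA lerDl addr_ge0//.
  exact: sumr_ge0.
by apply: sumr_ge0 => i _; exact: sumr_ge0.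
Unshelve. all: by end_near.
Qed.
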